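(* Let $S\in\Sigma^n$ be a string with $r_S$ equal-letter runs. The dynamic run-length encoded string data structure \texttt{rle\_str} implemented in \texttt{DYNAMIC} takes $$r_S\cdot\left(4\log(n/r_S)+\log|\Sigma|+4\log\log r_S+\mathcal{O}(\log n/\log r_S)\right)(1+o(1))+\mathcal{O}(|\Sigma|\log n)$$ bits of space and supports \texttt{rank}, \texttt{select}, \texttt{access}, and \texttt{insert} operations on $S$ in $\mathcal{O}(\log|\Sigma|\cdot\log r_S)$ time.
   Context: Logarithms are base 2. For a string $S$: $\texttt{access}(i)=S[i]$; $\texttt{rank}_c(i)$ = number of occurrences of $c$ in $S[0..i-1]$; $\texttt{select}_c(j)$ = position of the $j$-th occurrence of $c$; $\texttt{insert}(i,c)$ inserts $c$ at position $i$. An equal-letter run is a maximal substring consisting of a single repeated character. The structure \texttt{rle\_str} stores: a string $H\in\Sigma^{r_S}$ of the run heads (one character per run), as a wavelet tree over dynamic succinct bitvectors (fixed-size alphabet encoding, explicit topology of $\mathcal{O}(|\Sigma|\log n)$ bits); a bitvector $V_{all}[0..n-1]$ with a bit set at the last position of each run; and for each $c\in\Sigma$ a bitvector $V_c$ concatenating, for each run of $c$ of length $\ell$ in order, the pattern $0^{\ell-1}1$. All bitvectors $V_{all},V_c$ are dynamic gap-encoded bitvectors: a bitvector $0^{s_1-1}1\cdots0^{s_k-1}1$ is stored as a B-tree of constant fanout storing the gap lengths $s_1,\dots,s_k$ in leaves holding between $0.5\log k$ and $\log k$ integers each, packed with the bit-width of the largest integer in the leaf, internal nodes storing $\mathcal{O}(1)$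 partial-sum/size counters; such a bitvector of length $n'$ with $k$ ones uses at most $2k(\log(n'/k)+\log\log k+\mathcal{O}(\log n'/\log k))(1+o(1))$ bits and supports rank/select/access/insert/delete$_0$ in $\mathcal{O}(\log k)$ time. Example: $S=bc\#bbbbccccbaaaaaaaaaaa$ gives $H=bc\#bcba$, $V_{all}=11100010001100000000001$, $V_a=00000000001$, $V_b=100011$, $V_c=10001$, $V_\#=1$.
   Formalization: The o(1) is taken as r_S/|Σ| → ∞ (so as r_S → ∞ for fixed Σ), since an o(1) in r_S uniform in Σ fails for the given component bounds; log is read as max(1, log) in time bounds, denominators and under log log, so r_S ≤ 1 or |Σ| = 1 make sense. *)

(* Defs.v *)
From HB Require Import structures.
From mathcomp Require Import all_boot all_order all_algebra.
From mathcomp Require Import all_classical all_reals all_analysis.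

Set Implicit Arguments.
Unset Strict Implicit.
Unset Printing Implicit Defensive.

Import Order.TTheory GRing.Theory Num.Theory.
Import numFieldNormedType.Exports.

(** * Strings: positions are 0-based, occurrences are counted from 1 *)

Section Strings.
Variable T : eqType.
Implicit Types (S : seq T) (c : T) (i j : nat).

Definition str_rank c S i := count_mem c (take i S).

Definition str_select c S j :=
  nth (size S) [seq i <- iota 0 (size S) | nth c S i == c] j.-1.

Definition str_insert S i c := take i S ++ c :: drop i S.

Definition str_delete S i := take i S ++ drop i.+1 S.

(* The maximal equal-letter runs of S, from left to right, as (head, length). *)
Fixpoint runs S : seq (T * nat) :=
  if S is c :: S' then
    if runs S' is (d, l) :: rs then
      if c == d then (d, l.+1) :: rs else (c, 1) :: (d, l) :: rs
    else [:: (c, 1)]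
  else [::].

Definition nruns S := size (runs S).

Definition run_heads S := [seq x.1 | x <- runs S].

(* 0^(s_1 - 1) 1 ... 0^(s_k - 1) 1 *)
Definition gap_bits (gaps : seq nat) : seq bool :=
  flatten [seq rcons (nseq s.-1 false) true | s <- gaps].

Definition V_all S := gap_bits [seq x.2 | x <- runs S].

Definition V_of c S := gap_bits [seq x.2 | x <- runs S & x.1 == c].

Lemma runsK S : flatten [seq nseq x.2 x.1 | x <- runs S] = S.
Proof.
elim: S => //= c S; case: (runs S) => [|[d l] rs] /= IH; first by rewrite -IH.
by case: eqP => [->|_] /=; rewrite IH.
Qed.

Lemma runs_gt0 S : all (fun x => 0 < x.2) (runs S).
Proof.
by elim: S => //= c S; case: (runs S) => [|[d l] rs] //=; case: eqP => //= _ /andP[].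
Qed.

Lemma runs_maximal S : sorted (fun x y => x.1 != y.1) (runs S).
Proof.
elim: S => //= c S; case: (runs S) => [|[d l] rs] //=.
by case: eqP => [_|/eqP ncd] /=; [case: rs | rewrite ncd].
Qed.

End Strings.

(** * Cost-annotated computations

   A computation is a result together with the number of time units spent. *)

Definition cost (A : Type) : Type := (A * nat)%type.

Definition ret (A : Type) (a : A) : cost A := (a, 0).

(* Besides what its two parts spend, each sequencing step costs one unit, for
   the constant number of word operations (arithmetic, comparisons, one array
   or pointer access) performed between two calls. *)
Definition bind (A B : Type) (m : cost A) (f : A -> cost B) : cost B :=
  ((f m.1).1, (m.2 + (f m.1).2).+1).

Notation "'let!' x := m 'in' f" := (bind m (fun x => f))
  (at level 200, x name, m at level 100, f at level 200, right associativity).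

(** * Logarithms *)

Section Logs.
Variable R : realType.
Local Open Scope ring_scope.

Definition log2 (x : R) : R := ln x / ln 2.

(* max(1, log2 n): equal to log2 n for n >= 2, and 1 for n = 0, 1.  It is the
   meaning of "log n" wherever log n is a factor of an O(-) bound or a
   denominator, or is itself under a logarithm, so that the bounds also make
   sense for arguments 0 and 1. *)
Definition lg (n : nat) : R := Num.max 1 (log2 n%:R).

Definition returns (A : Type) (m : cost A) (P : A -> Prop) (t : R) : Prop :=
  P m.1 /\ m.2%:R <= t.

End Logs.

(** * Dynamic bitvectors *)

Record dyn_bv := DynBV {
  bv_car :> Type;
  bits : bv_car -> seq bool;
  bv_space : bv_car -> nat;
  bv_empty : bv_car;
  bv_access : bv_car -> nat -> cost bool;
  bv_rank : bv_car -> bool -> nat -> cost nat;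
  bv_select : bv_car -> bool -> nat -> cost nat;
  bv_insert : bv_car -> nat -> bool -> cost bv_car
}.

Record gap_bv := GapBV {
  gap_dyn :> dyn_bv;
  bv_delete0 : gap_dyn -> nat -> cost gap_dyn
}.

Section BitvectorSpecs.
Variable R : realType.
Local Open Scope ring_scope.

(* The operations are correct and run in time [t] on the bitvectors in [dom]. *)
Record supports (B : dyn_bv) (dom : pred (seq bool)) (t : seq bool -> R) :
    Prop := {
  supports_empty : bits (bv_empty B) = [::];
  supports_access : forall (v : B) i, dom (bits v) ->
    (i < size (bits v))%N ->
    returns (bv_access v i) (fun b => b = nth false (bits v) i) (t (bits v));
  supports_rank : forall (v : B) b i, dom (bits v) ->
    (i <= size (bits v))%N ->
    returns (bv_rank v b i) (fun k => k = str_rank b (bits v) i) (t (bits v));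
  supports_select : forall (v : B) b j, dom (bits v) ->
    (0 < j <= count_mem b (bits v))%N ->
    returns (bv_select v b j) (fun p => p = str_select b (bits v) j)
      (t (bits v));
  supports_insert : forall (v : B) i b, dom (bits v) ->
    (i <= size (bits v))%N -> dom (str_insert (bits v) i b) ->
    returns (bv_insert v i b) (fun v' => bits v' = str_insert (bits v) i b)
      (t (bits v))
}.

Definition ones (s : seq bool) : nat := count_mem true s.

(* Bitvectors of the form 0^(s_1 - 1) 1 ... 0^(s_k - 1) 1. *)
Definition gap_form : pred (seq bool) := fun s => last true s.

(* Bound, in bits, for length n and k ones.  For k <= 1 the expression
   2k(log(n/k) + loglog k + O(log n / log k))(1 + o(1)) is undefined or zero,
   and only O(log n) bits are assumed. *)
Definition gap_space_bound (C : R) (eps : nat -> R) (n k : nat) : R :=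
  if (k <= 1)%N then C * lg R n
  else 2 * k%:R
       * (log2 (n%:R / k%:R) + log2 (log2 k%:R) + C * (log2 n%:R / log2 k%:R))
       * (1 + eps k).

(* The performance of dynamic gap-encoded bitvectors. *)
Record gap_encoded (G : gap_bv) : Prop := {
  gap_space : exists (C : R) (eps : nat -> R),
    (eps @ \oo --> (0 : R))%classic /\
    forall v : G, gap_form (bits v) ->
      (bv_space v)%:R <= gap_space_bound C eps (size (bits v)) (ones (bits v));
  gap_time : exists C : R,
    supports G gap_form (fun s => C * lg R (ones s)) /\
    forall (v : G) i, gap_form (bits v) -> (i < size (bits v))%N ->
      nth false (bits v) i = false ->
      returns (bv_delete0 v i) (fun v' => bits v' = str_delete (bits v) i)
        (C * lg R (ones (bits v)))
}.

(* The performance of dynamic succinct bitvectors: m + o(m) bits and O(log m)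
   time for length m. *)
Record succinct (B : dyn_bv) : Prop := {
  succinct_space : exists f : nat -> R,
    ((fun m => f m / m%:R) @ \oo --> (0 : R))%classic /\
    forall v : B, (bv_space v)%:R <= (size (bits v))%:R + f (size (bits v));
  succinct_time : exists C : R,
    supports B predT (fun s => C * lg R (size s))
}.

End BitvectorSpecs.

(** * Wavelet tree, with codes of ceil(log2 |Sigma|) bits *)

Section Codes.
Variable Sigma : finType.

Definition code_len : nat := up_log 2 #|Sigma|.

Definition code (c : Sigma) : seq bool :=
  mkseq (fun i => odd (enum_rank c %/ 2 ^ i)) code_len.

Definition decode (w : seq bool) : cost (option Sigma) :=
  ([pick c | code c == w], size w).

End Codes.

Section Wavelet.
Variable B : dyn_bv.

Inductive wtree :=
| WLeaf
| WNode of B & wtree & wtree.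

Fixpoint wt_empty (d : nat) : wtree :=
  if d is d'.+1 then WNode (bv_empty B) (wt_empty d') (wt_empty d') else WLeaf.

(* [t] is the complete wavelet tree of depth [d] of the sequence [X] of words
   of length [d]. *)
Fixpoint wt_repr (d : nat) (t : wtree) (X : seq (seq bool)) : Prop :=
  match d, t with
  | 0, WLeaf => True
  | d'.+1, WNode b l r =>
      [/\ bits b = [seq head false w | w <- X],
          wt_repr d' l [seq behead w | w <- X & ~~ head false w]
        & wt_repr d' r [seq behead w | w <- X & head false w]]
  | _, _ => False
  end.

Fixpoint wt_nodes (t : wtree) : nat :=
  if t is WNode _ l r then (wt_nodes l + wt_nodes r).+1 else 1.

Fixpoint wt_bits_space (t : wtree) : nat :=
  if t is WNode b l r then bv_space b + wt_bits_space l + wt_bits_space r else 0.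

Fixpoint wt_access (t : wtree) (i : nat) : cost (seq bool) :=
  if t is WNode v l r then
    let! b := bv_access v i in
    let! k := bv_rank v b i in
    let! w := wt_access (if b then r else l) k in
    ret (b :: w)
  else ret [::].

Fixpoint wt_rank (t : wtree) (w : seq bool) (i : nat) : cost nat :=
  match t, w with
  | WNode v l r, b :: w' =>
      let! k := bv_rank v b i in
      wt_rank (if b then r else l) w' k
  | _, _ => ret i
  end.

Fixpoint wt_select (t : wtree) (w : seq bool) (j : nat) : cost nat :=
  match t, w with
  | WNode v l r, b :: w' =>
      let! p := wt_select (if b then r else l) w' j in
      bv_select v b p.+1
  | _, _ => ret j.-1
  end.

Fixpoint wt_insert (t : wtree) (i : nat) (w : seq bool) : cost wtree :=
  match t, w with
  | WNode v l r, b :: w' =>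
      let! k := bv_rank v b i in
      let! v' := bv_insert v i b in
      let! u := wt_insert (if b then r else l) k w' in
      ret (if b then WNode v' l u else WNode v' u r)
  | _, _ => ret t
  end.

End Wavelet.

(** * Run-length encoded strings *)

Section RleStr.
Variables (G : gap_bv) (B : dyn_bv) (Sigma : finType).

Record rle_str := RleStr {
  rle_len : nat;
  rle_H : wtree B;
  rle_all : G;
  rle_V : {ffun Sigma -> G}
}.

Definition rle_repr (st : rle_str) (S : seq Sigma) : Prop :=
  [/\ rle_len st = size S,
      wt_repr (code_len Sigma) (rle_H st) [seq code c | c <- run_heads S],
      bits (rle_all st) = V_all S
    & forall c, bits (rle_V st c) = V_of c S].

Definition rle_empty : rle_str :=
  RleStr 0 (wt_empty B (code_len Sigma)) (bv_empty G) [ffun=> bv_empty G].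

(* Number of bits of a machine word, enough for the integers 0..n. *)
Definition word_size (n : nat) : nat := (trunc_log 2 n).+1.

(* Total number of bits: the bitvectors; [K] words for each node of the
   explicit topology of the wavelet tree; one word for each pointer (to the V_c,
   V_all and H) and one for the length. *)
Definition rle_space (K : nat) (st : rle_str) : nat :=
  wt_bits_space (rle_H st) + bv_space (rle_all st)
  + \sum_(c : Sigma) bv_space (rle_V st c)
  + (K * wt_nodes (rle_H st) + #|Sigma| + 3) * word_size (rle_len st).

Definition head_at (t : wtree B) (k : nat) : cost (option Sigma) :=
  let! w := wt_access t k in decode Sigma w.

(* First position of the block 0^(s-1)1 of index k in a gap-form bitvector. *)
Definition block_start (v : G) (k : nat) : cost nat :=
  if k == 0 then ret 0 else let! p := bv_select v true k in ret p.+1.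

Definition rle_access (st : rle_str) (i : nat) : cost (option Sigma) :=
  let! k := bv_rank (rle_all st) true i in
  head_at (rle_H st) k.

Definition rle_rank (st : rle_str) (c : Sigma) (i : nat) : cost nat :=
  let! k := bv_rank (rle_all st) true i in
  let! s := block_start (rle_all st) k in
  let! kc := wt_rank (rle_H st) (code c) k in
  let! n := block_start (rle_V st c) kc in
  if i == s then ret n else
  let! h := head_at (rle_H st) k in
  ret (if h == Some c then n + (i - s) else n).

Definition rle_select (st : rle_str) (c : Sigma) (j : nat) : cost nat :=
  let! kc := bv_rank (rle_V st c) true j.-1 in
  let! sc := block_start (rle_V st c) kc in
  let! k := wt_select (rle_H st) (code c) kc.+1 in
  let! s := block_start (rle_all st) k in
  ret (s + (j.-1 - sc)).

Definition set_V (V : {ffun Sigma -> G}) (c : Sigma) (v : G) :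
    {ffun Sigma -> G} :=
  [ffun d => if d == c then v else V d].

(* Lengthens by one the run of index k, which is a run of c. *)
Definition rle_extend (st : rle_str) (k : nat) (c : Sigma) : cost rle_str :=
  let! s := block_start (rle_all st) k in
  let! va := bv_insert (rle_all st) s false in
  let! kc := wt_rank (rle_H st) (code c) k in
  let! sc := block_start (rle_V st c) kc in
  let! vc := bv_insert (rle_V st c) sc false in
  ret (RleStr (rle_len st).+1 (rle_H st) va (set_V (rle_V st) c vc)).

(* Adds a run of c of length one at position i, as the run of index k. *)
Definition rle_new_run (st : rle_str) (k i : nat) (c : Sigma) : cost rle_str :=
  let! va := bv_insert (rle_all st) i true in
  let! kc := wt_rank (rle_H st) (code c) k in
  let! sc := block_start (rle_V st c) kc in
  let! vc := bv_insert (rle_V st c) sc true in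
  let! t := wt_insert (rle_H st) k (code c) in
  ret (RleStr (rle_len st).+1 t va (set_V (rle_V st) c vc)).

(* Splits the run of index k, a run of d starting at s, before position i. *)
Definition rle_split (st : rle_str) (k s i : nat) (d : Sigma) : cost rle_str :=
  let! va0 := bv_delete0 (rle_all st) i.-1 in
  let! va := bv_insert va0 i.-1 true in
  let! kd := wt_rank (rle_H st) (code d) k in
  let! sd := block_start (rle_V st d) kd in
  let! vd0 := bv_delete0 (rle_V st d) (sd + (i - s)).-1 in
  let! vd := bv_insert vd0 (sd + (i - s)).-1 true in
  let! t := wt_insert (rle_H st) k (code d) in
  ret (RleStr (rle_len st) t va (set_V (rle_V st) d vd)).

Definition rle_insert (st : rle_str) (i : nat) (c : Sigma) : cost rle_str :=
  let! k := bv_rank (rle_all st) true i in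
  let! s := block_start (rle_all st) k in
  let! h := if i < rle_len st then head_at (rle_H st) k else ret None in
  if h == Some c then rle_extend st k c else
  if i == s then
    let! h' := if 0 < k then head_at (rle_H st) k.-1 else ret None in
    if h' == Some c then rle_extend st k.-1 c else rle_new_run st k i c
  else
    let! st' := rle_split st k s i (odflt c h) in
    rle_new_run st' k.+1 i c.

End RleStr.

Arguments rle_empty : clear implicits.

Section SpaceBound.
Variable R : realType.
Local Open Scope ring_scope.

(* r (4 log(n/r) + log sigma + 4 loglog r + C1 log n / log r) (1 + e)
   + C2 sigma log n.
   Here e is to be o(1) as r / sigma tends to infinity; in particular, over a
   fixed alphabet, as r tends to infinity. *)
Definition rle_space_bound (C1 C2 e : R) (n r sigma : nat) : R :=
  r%:R * (4 * log2 (n%:R / r%:R) + log2 sigma%:R + 4 * log2 (lg R r)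
          + C1 * (log2 n%:R / lg R r)) * (1 + e)
  + C2 * (sigma%:R * lg R n).

End SpaceBound.

(* Main.v *)
(** Every bitvector of the structure is determined by the list of runs, and a
    position of the string is a run together with an offset in it, so that each
    operation is a computation on a list of runs a ++ (c, l) :: b; the time bounds
    follow because every bitvector involved has at most r + 2 ones (or has
    length at most r + 2, for those of the wavelet tree).

    For the space, log n / log k = log (n/k) / log k + 1 shows that a gap-encoded
    bitvector takes 2k (log (n/k) + loglog k + O(1)) (1 + e) + O_e(log n) bits for
    every fixed e > 0.  Summing over the alphabet with Gibbs' inequality
    sum_c r_c log (n_c/r_c) <= r log (n/r), the whole structure takes
    (1 + e) r (4 log (n/r) + log sigma + 4 loglog r + O(1)) + O_e(sigma log n) bits.
    Finally sigma log n = sigma (log (n/r) + log sigma + log (r/sigma)) is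
    o(r (log (n/r) + log sigma + 1)) as r / sigma tends to infinity, so that the
    constant depending on e is absorbed by the main term, and r <= r log n / log r
    absorbs the O(r). *)

From mathcomp Require Import all_boot all_order all_algebra.
From mathcomp Require Import all_classical all_reals all_analysis.
From mathcomp Require Import zify ring lra.
Require Import Defs.

Set Implicit Arguments.
Unset Strict Implicit.
Unset Printing Implicit Defensive.

Import Order.TTheory GRing.Theory Num.Theory.
Import numFieldNormedType.Exports.

(** * Strings and gap encodings *)

Section Strings.
Variable T : eqType.
Implicit Types (S A : seq T) (c : T).

Lemma str_rank_cat c A S : str_rank c (A ++ S) (size A) = count_mem c A.
Proof. by rewrite /str_rank take_size_cat. Qed.

Lemma str_insert_cat A S c : str_insert (A ++ S) (size A) c = A ++ c :: S.
Proof. by rewrite /str_insert take_size_cat // drop_size_cat. Qed.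

Lemma str_delete_cat A c S : str_delete (A ++ c :: S) (size A) = A ++ S.
Proof.
by rewrite /str_delete take_size_cat // -cat_rcons drop_size_cat // size_rcons.
Qed.

Lemma size_occurrences c A S :
  size [seq i <- iota 0 (size A) | nth c (A ++ S) i == c] = count_mem c A.
Proof.
rewrite -[in RHS](mkseq_nth c A) /mkseq count_map size_filter.
apply: eq_in_count => i; rewrite mem_iota /= add0n => iA.
by rewrite nth_cat iA.
Qed.

(** The [j.-1] occurrences inside [A] fill the first entries of the list of occurrences, so entry
    [j.-1] is the first one after [A], namely the displayed [c]. *)
Lemma str_select_cat c A S j : 0 < j -> count_mem c A = j.-1 ->
  str_select c (A ++ c :: S) j = size A.
Proof.
move=> j0 cA; rewrite /str_select [X in iota 0 X]size_cat iotaD filter_cat.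
rewrite nth_cat size_occurrences cA ltnn subnn /= add0n.
by rewrite nth_cat ltnn subnn /= eqxx.
Qed.

End Strings.

(** * Gap encodings: rank, select and updates of blocks *)

Section GapBits.
Implicit Types (a b : seq nat).

Lemma gap_bits_cat a b : gap_bits (a ++ b) = gap_bits a ++ gap_bits b.
Proof. by rewrite /gap_bits map_cat flatten_cat. Qed.

Lemma gap_bits_cons l b : gap_bits (l :: b) = nseq l.-1 false ++ true :: gap_bits b.
Proof. by rewrite /gap_bits /= cat_rcons. Qed.

(** A zero gap would still be encoded by one bit, hence the positivity of the gaps. *)
Lemma size_gap_bits a : all (leq 1) a -> size (gap_bits a) = sumn a.
Proof.
elim: a => //= l a IH /andP[l0 /IH sa].
by rewrite gap_bits_cons size_cat /= size_nseq sa; lia.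
Qed.

Lemma ones_gap_bits a : ones (gap_bits a) = size a.
Proof.
rewrite /ones; elim: a => //= l a IH.
by rewrite gap_bits_cons count_cat count_nseq mul0n /= IH.
Qed.

Lemma gap_form_gap_bits a : gap_form (gap_bits a).
Proof.
case/lastP: a => // a l; rewrite -cats1 gap_bits_cat gap_bits_cons /gap_form.
by rewrite last_cat last_cat.
Qed.

(** The prefix consists of the blocks of [a], with a single one each, and of [o <= l.-1] zeros of
    the next block: rank turns a position into the index of its run. *)
Lemma rank_gap_bits a l b o : all (leq 1) a -> o < l ->
  str_rank true (gap_bits (a ++ l :: b)) (sumn a + o) = size a.
Proof.
move=> a0 ol; rewrite gap_bits_cat gap_bits_cons -(subnKC (_ : o <= l.-1)); last by lia.
rewrite nseqD -catA catA -size_gap_bits // -[X in _ + X](size_nseq o false).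
rewrite -size_cat str_rank_cat count_cat count_nseq mul0n addn0.
exact: ones_gap_bits.
Qed.

Lemma rank_gap_bits_all a : all (leq 1) a ->
  str_rank true (gap_bits a) (sumn a) = size a.
Proof.
move=> a0; rewrite -size_gap_bits // -[X in str_rank _ X _]cats0 str_rank_cat.
exact: ones_gap_bits.
Qed.

(** The selected one ends the block [l], so the next position starts the following block, as in
    [block_start]. *)
Lemma select_gap_bits a l b : all (leq 1) (rcons a l) ->
  (str_select true (gap_bits (rcons a l ++ b)) (size a).+1).+1 = sumn (rcons a l).
Proof.
rewrite all_rcons => /andP[l0 a0].
rewrite gap_bits_cat -cats1 gap_bits_cat gap_bits_cons -!catA cat_cons catA.
rewrite str_select_cat // ?size_cat ?size_nseq ?size_gap_bits ?sumn_cat //=; first by lia.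
by rewrite count_cat count_nseq mul0n addn0; exact: ones_gap_bits.
Qed.

Lemma gap_bits_insert0 a l b : all (leq 1) a -> 0 < l ->
  str_insert (gap_bits (a ++ l :: b)) (sumn a) false = gap_bits (a ++ l.+1 :: b).
Proof.
move=> a0 l0; rewrite !gap_bits_cat -size_gap_bits // str_insert_cat !gap_bits_cons.
by rewrite -[in RHS](prednK l0).
Qed.

Lemma gap_bits_insert1 a b : all (leq 1) a ->
  str_insert (gap_bits (a ++ b)) (sumn a) true = gap_bits (a ++ 1 :: b).
Proof.
by move=> a0; rewrite !gap_bits_cat -size_gap_bits // str_insert_cat gap_bits_cons.
Qed.

Section Split.
Variables (a b : seq nat) (l o : nat).
Hypotheses (a0 : all (leq 1) a) (ol : 0 < o < l).
(** Cutting a block after [o] positions turns its bit of offset [o.-1] into a one. [A] and [A'] are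
    what precedes and follows this bit, which is a zero because [o < l]. *)
Let A := gap_bits a ++ nseq o.-1 false.
Let A' := nseq (l - o).-1 false ++ true :: gap_bits b.

Let sizeA : size A = (sumn a + o).-1.
Proof. by rewrite size_cat size_nseq size_gap_bits //; lia. Qed.

Let gapE : gap_bits (a ++ l :: b) = A ++ false :: A'.
Proof.
rewrite gap_bits_cat gap_bits_cons /A /A' -catA; congr (_ ++ _).
have -> : l.-1 = o.-1 + (l - o).-1.+1 by lia.
by rewrite nseqD -catA.
Qed.

Lemma gap_bits_split_bit :
  (sumn a + o).-1 < size (gap_bits (a ++ l :: b)) /\
  nth false (gap_bits (a ++ l :: b)) (sumn a + o).-1 = false.
Proof.
by rewrite gapE -sizeA size_cat nth_cat ltnn subnn /= addnS ltnS leq_addr.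
Qed.

Let deleteE : str_delete (gap_bits (a ++ l :: b)) (sumn a + o).-1 = A ++ A'.
Proof. by rewrite gapE -sizeA str_delete_cat. Qed.

(** [A'] keeps the one that ends the cut block, so the intermediate bitvector still lies in the
    domain on which insertion is specified. *)
Lemma gap_form_split_delete :
  gap_form (str_delete (gap_bits (a ++ l :: b)) (sumn a + o).-1).
Proof.
have := gap_form_gap_bits b; rewrite /gap_form deleteE /A' !last_cat /=.
by case: (gap_bits b).
Qed.

Lemma ones_split_delete :
  ones (str_delete (gap_bits (a ++ l :: b)) (sumn a + o).-1) = (size a + size b).+1.
Proof.
rewrite deleteE /ones /A /A' !count_cat !count_nseq !mul0n /=.
by rewrite addn0 !add0n -!ones_gap_bits addnS.
Qed.

Lemma size_split_delete :
  (sumn a + o).-1 <= size (str_delete (gap_bits (a ++ l :: b)) (sumn a + o).-1).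
Proof. by rewrite deleteE size_cat sizeA leq_addr. Qed.

Lemma gap_bits_split :
  str_insert (str_delete (gap_bits (a ++ l :: b)) (sumn a + o).-1) (sumn a + o).-1 true
  = gap_bits (a ++ o :: l - o :: b).
Proof.
by rewrite deleteE -sizeA str_insert_cat /A /A' gap_bits_cat !gap_bits_cons -!catA.
Qed.

End Split.
End GapBits.

(** * Lists of runs and the strings they expand to *)

Section RunLists.
Variable T : eqType.
Implicit Types (rs a b : seq (T * nat)) (c d : T).

Definition expand rs := flatten [seq nseq x.2 x.1 | x <- rs].
Definition lens rs := [seq x.2 | x <- rs].
Definition runs_of c rs := [seq x <- rs | x.1 == c].

Lemma expand_cat a b : expand (a ++ b) = expand a ++ expand b.
Proof. by rewrite /expand map_cat flatten_cat. Qed.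

Lemma expand_cons c l b : expand ((c, l) :: b) = nseq l c ++ expand b.
Proof. by []. Qed.

Lemma size_expand rs : size (expand rs) = sumn (lens rs).
Proof. by elim: rs => //= -[c l] rs IH; rewrite expand_cons size_cat size_nseq IH. Qed.

Lemma lens_cat a b : lens (a ++ b) = lens a ++ lens b.
Proof. exact: map_cat. Qed.

Lemma runs_of_cat c a b : runs_of c (a ++ b) = runs_of c a ++ runs_of c b.
Proof. exact: filter_cat. Qed.

Lemma runs_of_head c l b : runs_of c ((c, l) :: b) = (c, l) :: runs_of c b.
Proof. by rewrite /runs_of /= eqxx. Qed.

Lemma runs_of_other c d l b : d != c -> runs_of d ((c, l) :: b) = runs_of d b.
Proof. by rewrite /runs_of /= eq_sym => /negbTE->. Qed.

Lemma count_expand c rs : count_mem c (expand rs) = sumn (lens (runs_of c rs)).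
Proof.
elim: rs => //= -[d l] rs IH; rewrite expand_cons count_cat IH count_nseq /runs_of /=.
by case: eqP => _; rewrite ?mul1n ?mul0n.
Qed.

Lemma all_lens_runs_of c rs : all (leq 1) (lens rs) -> all (leq 1) (lens (runs_of c rs)).
Proof.
by elim: rs => //= x rs IH /andP[x0 /IH]; case: eqP => //= _; rewrite x0.
Qed.

Lemma locate_position rs i : i < sumn (lens rs) ->
  exists a c l b o, [/\ rs = a ++ (c, l) :: b, i = sumn (lens a) + o & o < l].
Proof.
elim: rs i => //= -[c l] rs IH i /= ilt; case: (ltnP i l) => il.
  by exists [::], c, l, rs, i.
have [|a [d [m [b [ o [ -> io om]]]]]] := IH (i - l); first by lia.
by exists ((c, l) :: a), d, m, b, o; split=> //=; lia.
Qed.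

(** Counterpart of [locate_position] for select: [i] is a 0-based index among the occurrences of
    [c], and [o] is the offset inside the run that contains it. *)
Lemma locate_occurrence c rs i : i < sumn (lens (runs_of c rs)) ->
  exists a l b o,
    [/\ rs = a ++ (c, l) :: b, i = sumn (lens (runs_of c a)) + o & o < l].
Proof.
elim: rs i => //= -[d l] rs IH i /=; case: (d =P c) => [->|/eqP dc] /= ilt.
  case: (ltnP i l) => il; first by exists [::], l, rs, i.
  have [|a [m [b [ o [ -> io om]]]]] := IH (i - l); first by lia.
  by exists ((c, l) :: a), m, b, o; split=> //=; rewrite eqxx /=; lia.
have [a [m [b [ o [ -> io om]]]]] := IH i ilt.
by exists ((d, l) :: a), m, b, o; split=> //=; rewrite (negbTE dc).
Qed.

Definition maximal rs := sorted (fun x y : T * nat => x.1 != y.1) rs.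

(** Converse of [runsK]: with positive lengths and distinct adjacent heads, a list of runs is
    recovered from its string. It identifies the runs of the string obtained by an insertion. *)
Lemma runs_expand rs : all (leq 1) (lens rs) -> maximal rs -> runs (expand rs) = rs.
Proof.
elim: rs => //= -[c l] rs IH /= /andP[l0 rs0] mrs.
have {}IH : runs (expand rs) = rs by apply: IH => //; exact: path_sorted mrs.
have {}mrs : if rs is x :: _ then c != x.1 else true.
  by case: rs mrs {rs0 IH} => //= x rs /andP[].
rewrite expand_cons; case: l l0 => // l _.
elim: l => [|l IHl] /=; last by rewrite /= in IHl; rewrite IHl eqxx.
by rewrite IH; case: rs mrs {rs0 IH} => //= -[d m] rs /= /negbTE->.
Qed.

Lemma maximal_extend a c l l' b :
  maximal (a ++ (c, l) :: b) -> maximal (a ++ (c, l') :: b).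
Proof.
rewrite /maximal; case: a => [|x a] /=; first by case: b.
by rewrite !cat_path /=; case: b.
Qed.

Lemma maximal_cat a b : maximal (a ++ b) -> maximal a /\ maximal b.
Proof.
rewrite /maximal; case: a => [|x a] //=; rewrite cat_path => /andP[ -> bs].
by split=> //; exact: path_sorted bs.
Qed.

(** The only new adjacencies are those of the inserted run with its two neighbours; at an end of the
    list the corresponding condition is vacuous. *)
Lemma maximal_insert a c l b : maximal a -> maximal b ->
  (forall a' d m, a = rcons a' (d, m) -> d != c) ->
  (forall d m b', b = (d, m) :: b' -> d != c) ->
  maximal (a ++ (c, l) :: b).
Proof.
move=> ma mb ha hb.
have mcb : path (fun x y : T * nat => x.1 != y.1) (c, l) b.
  by case: b mb hb => //= [[d m] b'] /= -> hb; rewrite eq_sym (hb d m b').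
case/lastP: a ma ha => // a [d m] ma ha; rewrite cat_rcons /maximal.
have dc := ha a d m erefl.
move: ma; rewrite /maximal -cats1; case: a {ha} => [|x a] /=; first by rewrite dc.
by rewrite !cat_path /= andbT dc => /andP[ -> ->].
Qed.

End RunLists.

(** * Cost-annotated wavelet trees *)

Section Cost.
Variable R : realType.
Local Open Scope ring_scope.

Lemma returns_weaken (A : Type) (m : cost A) (P Q : A -> Prop) (t u : R) :
  returns m P t -> (forall a, P a -> Q a) -> t <= u -> returns m Q u.
Proof. by case=> Pm mt PQ tu; split; [exact: PQ | exact: le_trans mt tu]. Qed.

Lemma returns_ret (A : Type) (a : A) (P : A -> Prop) (t : R) :
  P a -> 0 <= t -> returns (ret a) P t.
Proof. by []. Qed.

Lemma returns_bind (A C : Type) (m : cost A) (f : A -> cost C)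
    (P : A -> Prop) (Q : C -> Prop) (t1 t2 t : R) :
  returns m P t1 -> (forall a, P a -> returns (f a) Q t2) ->
  t1 + t2 + 1 <= t -> returns (bind m f) Q t.
Proof.
move=> [Pm mt] Hf le_t; have [Qf ft] := Hf _ Pm; split=> //=.
by apply: le_trans le_t; rewrite -natr1 natrD; lra.
Qed.

End Cost.

(** * Binary codes of the letters *)

Section Codes.
Variable Sigma : finType.

Lemma size_code (c : Sigma) : size (code c) = code_len Sigma.
Proof. exact: size_mkseq. Qed.

(** Parity recovers the lowest bit, and halving both numbers shifts the other bits into the range of
    the induction hypothesis. *)
Lemma bits_inj d m n : m < 2 ^ d -> n < 2 ^ d ->
  (forall i, i < d -> odd (m %/ 2 ^ i) = odd (n %/ 2 ^ i)) -> m = n.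
Proof.
elim: d m n => [|d IH] m n; first by rewrite expn0; lia.
rewrite expnS => md nd mn.
have mn0 : odd m = odd n by have := mn 0; rewrite expn0 !divn1; exact.
have mn2 : m %/ 2 = n %/ 2.
  apply: IH; [by lia | by lia |] => i id; have := mn i.+1 id.
  by rewrite expnS !divnMA.
by rewrite (divn_eq m 2) (divn_eq n 2) mn2 !modn2 mn0.
Qed.

Lemma code_inj : injective (@code Sigma).
Proof.
move=> c d cd; apply/enum_rank_inj/val_inj => /=.
have lt2 (e : Sigma) : enum_rank e < 2 ^ code_len Sigma.
  by apply: leq_trans (ltn_ord _) _; exact: up_logP.
apply: bits_inj (lt2 c) (lt2 d) _ => i id.
by have := congr1 (fun w => nth false w i) cd; rewrite !nth_mkseq.
Qed.

Lemma decode_code (c : Sigma) : decode Sigma (code c) = (Some c, code_len Sigma).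
Proof.
rewrite /decode size_code; case: pickP => [d /eqP/code_inj->//|/(_ c)].
by rewrite eqxx.
Qed.

End Codes.

(** * Sequences held by the children of a wavelet node *)

Section Children.
Implicit Types (X A : seq (seq bool)) (w : seq bool) (b : bool).

(** One form, indexed by [b], of the two filters in [wt_repr], so that both children are treated at
    once. *)
Definition wt_child b X := [seq behead w | w <- X & head false w == b].

Lemma wt_child_cat b X A : wt_child b (X ++ A) = wt_child b X ++ wt_child b A.
Proof. by rewrite /wt_child filter_cat map_cat. Qed.

(** Applied to a prefix, this says that rank in the bitvector of a node gives the matching position
    in the child. *)
Lemma size_wt_child b X :
  size (wt_child b X) = count_mem b [seq head false w | w <- X].
Proof. by rewrite size_map size_filter count_map. Qed.

Lemma size_wt_child_le b X : size (wt_child b X) <= size X.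
Proof. by rewrite size_map size_filter count_size. Qed.

Lemma all_wt_child d b X : all (fun w => size w == d.+1) X ->
  all (fun w => size w == d) (wt_child b X).
Proof.
elim: X => //= -[|x w] X IH //= /andP[wd /IH]; rewrite /wt_child /=.
by case: (x == b) => //= ->; rewrite andbT.
Qed.

(** Words have length [d.+1], which excludes the empty word: the default head [false] would send it
    to the left child. *)
Lemma count_wt_child d b w X : all (fun w => size w == d.+1) X ->
  count_mem w (wt_child b X) = count_mem (b :: w) X.
Proof.
elim: X => //= -[|x u] X IH //= /andP[wd /IH {}IH].
by rewrite /wt_child /= eqseq_cons; case: (x == b); rewrite /= -IH.
Qed.

Lemma wt_repr_child (B : dyn_bv) d (v : B) l r X b :
  wt_repr d.+1 (WNode v l r) X ->
  wt_repr d (if b then r else l) (wt_child b X).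
Proof.
case=> _ Hl Hr; rewrite /wt_child; case: b.
  by rewrite (eq_filter (a2 := fun w => head false w)) // => w; rewrite eqb_id.
by rewrite (eq_filter (a2 := fun w => ~~ head false w)) // => w; rewrite eqbF_neg.
Qed.

End Children.

(** * Correctness and time of the wavelet tree operations *)

Section Wavelet.
Variables (R : realType) (B : dyn_bv) (N : nat) (tB : R).
Local Open Scope ring_scope.
Hypothesis tB0 : 0 <= tB.
Hypothesis supB : supports B (fun s => (size s <= N)%N) (fun=> tB).
Implicit Types (X A : seq (seq bool)) (w : seq bool).

(** A level costs at most two bitvector operations and three sequencing steps; access and insertion
    reach this. *)
Definition wt_time d : R := d%:R * (2 * tB + 3).

Lemma wt_time_ge0 d : 0 <= wt_time d.
Proof. by rewrite mulr_ge0 ?ler0n //; move: tB0; lra. Qed.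

Lemma wt_timeS d : wt_time d.+1 = wt_time d + (2 * tB + 3).
Proof. by rewrite /wt_time -natr1; ring. Qed.

Local Hint Resolve wt_time_ge0 : core.

Lemma wt_access_correct d (t : wtree B) A w A' :
  wt_repr d t (A ++ w :: A') -> all (fun w => size w == d) (A ++ w :: A') ->
  (size (A ++ w :: A') <= N)%N ->
  returns (wt_access t (size A)) (fun u => u = w) (wt_time d).
Proof.
elim: d t A w A' => [|d IH] [|v l r] A w A' //.
  by move=> _ Xd _; apply: returns_ret => //; apply/esym/size0nil/eqP/(allP Xd);
     rewrite mem_cat inE eqxx orbT.
move=> tX Xd XN; have [vX _ _] := tX.
have vN : (size (bits v) <= N)%N by rewrite vX size_map.
have : size w == d.+1 by apply: (allP Xd); rewrite mem_cat inE eqxx orbT.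
case: w tX Xd XN vX => // b w tX Xd XN vX wd.
have vi : (size A < size (bits v))%N.
  by rewrite vX size_map size_cat /=; lia.
rewrite wt_timeS /=.
apply: (returns_bind (supports_access supB vN vi)) => [_ ->|].
  have -> : nth false (bits v) (size A) = b.
    by rewrite vX (nth_map [::]) ?nth_cat ?ltnn ?subnn // size_cat /=; lia.
  apply: (returns_bind (supports_rank supB _ vN (ltnW vi))) => [_ ->|].
    rewrite vX map_cat -(size_map (head false) A) str_rank_cat -size_wt_child.
    have bX : wt_child b (A ++ (b :: w) :: A') =
        wt_child b A ++ w :: wt_child b A'.
      by rewrite wt_child_cat /wt_child /= eqxx.
    have IHb : returns (wt_access (if b then r else l) (size (wt_child b A)))
        (fun u => u = w) (wt_time d).
      apply: (IH _ _ w (wt_child b A')); rewrite -bX.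
      - exact: (wt_repr_child _ tX).
      - exact: all_wt_child.
      - exact: leq_trans (size_wt_child_le _ _) XN.
    apply: (returns_bind IHb) => [_ ->|]; first exact: (@returns_ret _ _ _ _ 0).
    exact: lexx.
  exact: lexx.
by move: tB0; lra.
Qed.

Lemma wt_rank_correct d (t : wtree B) A A' w :
  wt_repr d t (A ++ A') -> all (fun w => size w == d) (A ++ A') ->
  (size (A ++ A') <= N)%N -> size w = d ->
  returns (wt_rank t w (size A)) (fun k => k = count_mem w A) (wt_time d).
Proof.
elim: d t A A' w => [|d IH] [|v l r] A A' w //.
  move=> _; rewrite all_cat => /andP[Xd _] _ /size0nil ->; apply: returns_ret => //.
  by apply/esym/eqP; rewrite -all_count; apply: sub_all Xd => u /nilP->.
move=> tX Xd XN; have [vX _ _] := tX.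
have vN : (size (bits v) <= N)%N by rewrite vX size_map.
case: w => // b w [wd].
have vi : (size A <= size (bits v))%N by rewrite vX size_map size_cat leq_addr.
rewrite wt_timeS /=.
apply: (returns_bind (supports_rank supB _ vN vi)) => [_ ->|].
  rewrite vX map_cat -(size_map (head false) A) str_rank_cat -size_wt_child.
  have := Xd; rewrite all_cat => /andP[Ad _]; rewrite -(count_wt_child _ _ Ad).
  apply: (IH _ _ (wt_child b A') w); rewrite -?wt_child_cat //.
  - exact: (wt_repr_child _ tX).
  - exact: all_wt_child.
  - exact: leq_trans (size_wt_child_le _ _) XN.
by move: tB0; lra.
Qed.

Lemma wt_select_correct d (t : wtree B) A w A' :
  wt_repr d t (A ++ w :: A') -> all (fun w => size w == d) (A ++ w :: A') ->
  (size (A ++ w :: A') <= N)%N ->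
  returns (wt_select t w (count_mem w A).+1) (fun p => p = size A) (wt_time d).
Proof.
elim: d t A w A' => [|d IH] [|v l r] A w A' //.
  move=> _; rewrite all_cat => /and3P[Xd /nilP-> _] _; apply: returns_ret => //=.
  by apply/eqP; rewrite -all_count; apply: sub_all Xd => u /nilP->.
move=> tX Xd XN; have [vX _ _] := tX.
have vN : (size (bits v) <= N)%N by rewrite vX size_map.
have : size w == d.+1 by apply: (allP Xd); rewrite mem_cat inE eqxx orbT.
case: w tX Xd XN vX => // b w tX Xd XN vX wd.
rewrite wt_timeS /=.
have bX : wt_child b (A ++ (b :: w) :: A') = wt_child b A ++ w :: wt_child b A'.
  by rewrite wt_child_cat /wt_child /= eqxx.
have := Xd; rewrite all_cat => /andP[Ad _]; rewrite -(count_wt_child _ _ Ad).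
have IHb : returns (wt_select (if b then r else l) w (count_mem w (wt_child b A)).+1)
    (fun p => p = size (wt_child b A)) (wt_time d).
  apply: (IH _ _ w (wt_child b A')); rewrite -bX.
  - exact: (wt_repr_child _ tX).
  - exact: all_wt_child.
  - exact: leq_trans (size_wt_child_le _ _) XN.
(* The child returns a 0-based position, whereas select counts from 1: the bit sought is the
   occurrence of [b] numbered one more than that position. *)
apply: (returns_bind IHb) => [_ ->|].
  rewrite size_wt_child.
  apply: (returns_weaken (supports_select supB vN _)); last exact: lexx.
    by rewrite vX map_cat count_cat /= eqxx; lia.
  move=> _ ->; rewrite vX map_cat /= -[RHS](size_map (head false)).
  exact: str_select_cat.
by move: tB0; lra.
Qed.

(** The size is strictly below [N] because every visited bitvector gains one bit and must stay
    within the bound. *)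
Lemma wt_insert_correct d (t : wtree B) A A' w :
  wt_repr d t (A ++ A') -> all (fun w => size w == d) (A ++ A') ->
  (size (A ++ A') < N)%N -> size w = d ->
  returns (wt_insert t (size A) w) (fun u => wt_repr d u (A ++ w :: A')) (wt_time d).
Proof.
elim: d t A A' w => [|d IH] [|v l r] A A' w //.
move=> tX Xd XN; have [vX tl tr] := tX.
have vN : (size (bits v) < N)%N by rewrite vX size_map.
case: w => // b w [wd].
have vi : (size A <= size (bits v))%N by rewrite vX size_map size_cat leq_addr.
rewrite wt_timeS /=.
have vE : str_insert (bits v) (size A) b =
    [seq head false u | u <- A ++ (b :: w) :: A'].
  by rewrite vX !map_cat /= -(size_map (head false) A) str_insert_cat.
apply: (returns_bind (supports_rank supB _ (ltnW vN) vi)) => [_ ->|].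
  apply: (returns_bind (supports_insert supB (ltnW vN) vi (b := b) _)).
  - by rewrite vE size_map; move: XN; rewrite !size_cat /= addnS.
  - move=> v' v'E; rewrite vX map_cat -(size_map (head false) A) str_rank_cat.
    rewrite -size_wt_child.
    apply: returns_bind.
    + apply: (IH _ _ (wt_child b A') w); rewrite -?wt_child_cat //.
      * exact: (wt_repr_child _ tX).
      * exact: all_wt_child.
      * exact: leq_ltn_trans (size_wt_child_le _ _) XN.
    + move=> u uX; apply: (@returns_ret _ _ _ _ 0) => //.
      have {}uX : wt_repr d u (wt_child b (A ++ (b :: w) :: A')).
        by rewrite wt_child_cat {2}/wt_child /= eqxx.
      have repr_head x Y :
          [seq behead z | z <- Y & if x then head false z else ~~ head false z]
          = wt_child x Y.
        by rewrite /wt_child; congr map; apply: eq_filter => z; case: x;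
           rewrite ?eqb_id ?eqbF_neg.
      (* The new word starts with [b], so the child on the other side keeps its sequence. *)
      have repr_other :
          wt_repr d (if b then l else r) (wt_child (~~ b) (A ++ (b :: w) :: A')).
        have -> : wt_child (~~ b) (A ++ (b :: w) :: A') = wt_child (~~ b) (A ++ A').
          by rewrite !wt_child_cat {2}/wt_child /=; case: (b).
        by have := wt_repr_child (~~ b) tX; case: (b).
      have {}v'E := etrans v'E vE.
      case: (b) uX repr_other v'E => uX repr_other v'E; split=> //.
      - by have := repr_head false (A ++ (true :: w) :: A') => /= ->.
      - by have := repr_head true (A ++ (true :: w) :: A') => /= ->.
      - by have := repr_head false (A ++ (false :: w) :: A') => /= ->.
      - by have := repr_head true (A ++ (false :: w) :: A') => /= ->.
    + exact: lexx.
  - exact: lexx.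
by move: tB0; lra.
Qed.

End Wavelet.

(** * Operations on run-length encoded strings *)

Section RleOperations.
Variables (R : realType) (G : gap_bv) (B : dyn_bv) (Sigma : finType).
Variables (N : nat) (tB T : R).
Hypothesis T1 : (1 <= T)%R.
Hypothesis tB0 : (0 <= tB)%R.
Hypothesis supG : supports G (fun s => gap_form s && (ones s <= N)) (fun=> T).
Hypothesis supG_delete : forall (v : G) i, gap_form (bits v) -> ones (bits v) <= N ->
  i < size (bits v) -> nth false (bits v) i = false ->
  returns (bv_delete0 v i) (fun v' => bits v' = str_delete (bits v) i) T.
Hypothesis supB : supports B (fun s => size s <= N) (fun=> tB).
Hypothesis wt_time_le : (wt_time tB (code_len Sigma) <= T)%R.
Hypothesis code_len_le : ((code_len Sigma)%:R <= T)%R.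

Implicit Types (st : rle_str G B Sigma) (rs a b : seq (Sigma * nat)) (c : Sigma).

Let T0 : (0 <= T)%R. Proof. exact: le_trans T1. Qed.

(** Time is budgeted in multiples of [T]. As [1 <= T], the unit charged by [bind] is paid by one
    further [T], which leaves [k - k1.+1] of them for the continuation. *)
Let bindT A C (m : cost A) (f : A -> cost C) P Q k1 k :
  returns m P (k1%:R * T)%R ->
  (forall x, P x -> returns (f x) Q ((k - k1.+1)%:R * T)%R) ->
  k1 < k -> returns (bind m f) Q (k%:R * T)%R.
Proof.
move=> Hm Hf k1k; apply: (returns_bind Hm Hf).
have -> : (k%:R = (k - k1.+1)%:R + k1%:R + 1 :> R)%R.
  by rewrite -natrD natr1; congr (_%:R)%R; lia.
by move: T1 => ?; lra.
Qed.

Let retT A (x : A) (P : A -> Prop) k : P x -> returns (ret x) P (k%:R * T)%R.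
Proof. by move=> Px; apply: returns_ret => //; rewrite mulr_ge0 ?ler0n. Qed.

Let unitT A (m : cost A) P : returns m P T -> returns m P (1%:R * T)%R.
Proof. by rewrite mul1r. Qed.

Let weakT A (m : cost A) (P Q : A -> Prop) k1 k :
  returns m P (k1%:R * T)%R -> (forall x, P x -> Q x) -> k1 <= k ->
  returns m Q (k%:R * T)%R.
Proof.
by move=> Hm PQ k1k; apply: (returns_weaken Hm PQ); rewrite ler_wpM2r // ler_nat.
Qed.

(* Like [rle_repr], but for any list of runs: adjacent runs may have the same
   head, as happens in the middle of an insertion that splits a run. *)
Record represents st rs : Prop := {
  repr_pos : all (leq 1) (lens rs);
  repr_len : rle_len st = sumn (lens rs);
  repr_H : wt_repr (code_len Sigma) (rle_H st) [seq code x.1 | x <- rs];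
  repr_all : bits (rle_all st) = gap_bits (lens rs);
  repr_V : forall c, bits (rle_V st c) = gap_bits (lens (runs_of c rs))
}.

Lemma rle_reprE st (S : seq Sigma) : rle_repr st S <-> represents st (runs S).
Proof.
have pos : all (leq 1) (lens (runs S)) by rewrite all_map; exact: runs_gt0.
have sz : size S = sumn (lens (runs S)) by rewrite -size_expand -[in LHS](runsK S).
have heads : [seq code c | c <- run_heads S] = [seq code x.1 | x <- runs S].
  by rewrite -map_comp.
split=> [[]|[]] Hl HH Ha HV; first by split; rewrite -?sz // -heads.
by move=> HV'; split; rewrite ?sz ?heads.
Qed.

(** * Queries and updates on a represented list of runs *)

Section Primitives.
Variables (st : rle_str G B Sigma) (rs : seq (Sigma * nat)).
Hypothesis st_rs : represents st rs.
Hypothesis rsN : size rs <= N.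

Let pos a b : rs = a ++ b -> all (leq 1) (lens a) /\ all (leq 1) (lens b).
Proof.
by have := repr_pos st_rs => + E; rewrite E lens_cat all_cat => /andP[].
Qed.

Let gapN l : size l <= N -> gap_form (gap_bits l) && (ones (gap_bits l) <= N).
Proof. by rewrite gap_form_gap_bits ones_gap_bits. Qed.

Let all_dom : gap_form (bits (rle_all st)) && (ones (bits (rle_all st)) <= N).
Proof. by rewrite (repr_all st_rs) gapN // size_map. Qed.

Let V_dom c : gap_form (bits (rle_V st c)) && (ones (bits (rle_V st c)) <= N).
Proof.
rewrite (repr_V st_rs) gapN // size_map (leq_trans _ rsN) // size_filter.
exact: count_size.
Qed.

Lemma rank_run_correct (v : G) l1 l l2 o : bits v = gap_bits (l1 ++ l :: l2) ->
  size (l1 ++ l :: l2) <= N -> all (leq 1) (l1 ++ l :: l2) -> o < l ->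
  returns (bv_rank v true (sumn l1 + o)) (fun k => k = size l1) (1%:R * T)%R.
Proof.
move=> vE lN l0 ol; apply: unitT.
have l10 : all (leq 1) l1 by move: l0; rewrite all_cat => /andP[].
apply: (returns_weaken (supports_rank supG _ _ _)); rewrite ?vE ?gapN //.
  by rewrite size_gap_bits // sumn_cat /=; lia.
by move=> _ ->; rewrite rank_gap_bits.
Qed.

(** The first block starts at 0 without any query; otherwise one select and one sequencing step make
    up the budget 2. *)
Lemma block_start_correct (v : G) l1 l2 : bits v = gap_bits (l1 ++ l2) ->
  size (l1 ++ l2) <= N -> all (leq 1) l1 ->
  returns (block_start v (size l1)) (fun s => s = sumn l1) (2%:R * T)%R.
Proof.
move=> vE lN; rewrite /block_start; case/lastP: l1 vE lN => [|l1 l] vE lN l10.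
  exact: retT.
rewrite size_rcons /=; apply: (bindT (k1 := 1) (unitT (supports_select supG _ _))) => //.
- by rewrite vE gapN.
- by rewrite vE [count_mem true _]ones_gap_bits size_cat size_rcons; lia.
- by move=> _ ->; apply: retT; rewrite vE select_gap_bits.
Qed.

Lemma all_rank_correct a c l b o : rs = a ++ (c, l) :: b -> o < l ->
  returns (bv_rank (rle_all st) true (sumn (lens a) + o)) (fun k => k = size a)
    (1%:R * T)%R.
Proof.
move=> rsE ol; rewrite -(size_map snd a).
apply: (@rank_run_correct _ _ l (lens b)) => //;
  rewrite -[_ ++ _](map_cat _ a ((c, l) :: b)) -rsE.
- exact: repr_all.
- by rewrite size_map.
- exact: (repr_pos st_rs).
Qed.

Lemma all_rank_end_correct :
  returns (bv_rank (rle_all st) true (sumn (lens rs))) (fun k => k = size rs)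
    (1%:R * T)%R.
Proof.
apply: unitT; rewrite -(size_map snd rs).
apply: (returns_weaken (supports_rank supG _ all_dom _)); rewrite ?(repr_all st_rs) //.
  by rewrite size_gap_bits // (repr_pos st_rs).
by move=> _ ->; rewrite rank_gap_bits_all // (repr_pos st_rs).
Qed.

Lemma all_block_start_correct a b : rs = a ++ b ->
  returns (block_start (rle_all st) (size a)) (fun s => s = sumn (lens a)) (2%:R * T)%R.
Proof.
move=> rsE; rewrite -(size_map snd a).
apply: (@block_start_correct _ _ (lens b)); rewrite -?lens_cat -?rsE.
- exact: repr_all.
- by rewrite size_map.
- by case: (pos rsE).
Qed.

Let V_split c a b : rs = a ++ b -> [/\
  bits (rle_V st c) = gap_bits (lens (runs_of c a) ++ lens (runs_of c b)),
  size (lens (runs_of c a) ++ lens (runs_of c b)) <= N,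
  all (leq 1) (lens (runs_of c a)) & all (leq 1) (lens (runs_of c b))].
Proof.
move=> rsE; have [a0 b0] := pos rsE; rewrite -lens_cat -runs_of_cat -rsE.
split; rewrite ?all_lens_runs_of //; first exact: repr_V.
by rewrite size_map (leq_trans _ rsN) // size_filter count_size.
Qed.

Lemma V_rank_correct a c l b o : rs = a ++ (c, l) :: b -> o < l ->
  returns (bv_rank (rle_V st c) true (sumn (lens (runs_of c a)) + o))
    (fun k => k = size (runs_of c a)) (1%:R * T)%R.
Proof.
move=> rsE ol; rewrite -(size_map snd (runs_of c a)).
have [VE VN a0] := V_split c rsE; move: VE VN; rewrite runs_of_head /=.
move=> VE VN b0; apply: (@rank_run_correct _ _ l (lens (runs_of c b))) => //.
by rewrite all_cat a0.
Qed.

Lemma V_block_start_correct c a b : rs = a ++ b ->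
  returns (block_start (rle_V st c) (size (runs_of c a)))
    (fun s => s = sumn (lens (runs_of c a))) (2%:R * T)%R.
Proof.
move=> rsE; rewrite -(size_map snd (runs_of c a)).
by have [VE VN a0 b0] := V_split c rsE; exact: (block_start_correct VE VN a0).
Qed.

Let codes a := [seq code x.1 | x <- a].

Let codes_size a : all (fun w => size w == code_len Sigma) (codes a).
Proof. by rewrite all_map; apply/allP => x _ /=; rewrite size_code. Qed.

Let codesN : size (codes rs) <= N. Proof. by rewrite size_map. Qed.

Let codes_cat a b : codes (a ++ b) = codes a ++ codes b.
Proof. exact: map_cat. Qed.

Let count_codes c a : count_mem (code c) (codes a) = size (runs_of c a).
Proof.
rewrite size_filter count_map; apply: eq_count => x /=.
exact: (inj_eq (@code_inj Sigma)).
Qed.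

(** Rank in the string of heads translates the index of a run into an index among the runs of [c],
    hence into a block of [V_c]; [H_select_correct] goes back. *)
Lemma H_rank_correct c a b : rs = a ++ b ->
  returns (wt_rank (rle_H st) (code c) (size a)) (fun k => k = size (runs_of c a))
    (1%:R * T)%R.
Proof.
move=> rsE; apply: unitT; rewrite -count_codes -(size_map (fun x => code x.1) a).
have := @wt_rank_correct _ _ _ _ tB0 supB (code_len Sigma) (rle_H st) (codes a)
  (codes b) (code c).
rewrite -codes_cat -rsE => H; apply: (returns_weaken (H _ _ _ _)) => //.
- exact: repr_H.
- exact: size_code.
Qed.

Lemma H_select_correct c l a b : rs = a ++ (c, l) :: b ->
  returns (wt_select (rle_H st) (code c) (size (runs_of c a)).+1) (fun k => k = size a)
    (1%:R * T)%R.
Proof.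
move=> rsE; apply: unitT; rewrite -count_codes -(size_map (fun x => code x.1) a).
have := @wt_select_correct _ _ _ _ tB0 supB (code_len Sigma) (rle_H st) (codes a)
  (code c) (codes b).
rewrite -[code c :: _]/(codes ((c, l) :: b)) -codes_cat -rsE => H.
by apply: (returns_weaken (H _ _ _)) => //; exact: repr_H.
Qed.

Lemma head_at_correct c l a b : rs = a ++ (c, l) :: b ->
  returns (head_at Sigma (rle_H st) (size a)) (fun h => h = Some c) (3%:R * T)%R.
Proof.
move=> rsE; rewrite -(size_map (fun x => code x.1) a).
have := @wt_access_correct _ _ _ _ tB0 supB (code_len Sigma) (rle_H st) (codes a)
  (code c) (codes b).
rewrite -[code c :: _]/(codes ((c, l) :: b)) -codes_cat -rsE => H.
apply: (bindT (k1 := 1) (P := fun w => w = code c)) => //; last first.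
  move=> _ ->; rewrite decode_code; split=> //=; rewrite mul1r.
  exact: code_len_le.
apply/unitT/(returns_weaken (H _ _ _)) => //; exact: repr_H.
Qed.

Lemma H_insert_correct c a b : rs = a ++ b -> size rs < N ->
  returns (wt_insert (rle_H st) (size a) (code c))
    (fun t => wt_repr (code_len Sigma) t [seq code x.1 | x <- a ++ (c, 1) :: b])
    (1%:R * T)%R.
Proof.
move=> rsE rsN'; apply: unitT; rewrite -(size_map (fun x => code x.1) a).
have := @wt_insert_correct _ _ _ _ tB0 supB (code_len Sigma) (rle_H st) (codes a)
  (codes b) (code c).
rewrite -[code c :: _]/(codes ((c, 1) :: b)) -!codes_cat -rsE => H.
apply: (returns_weaken (H _ _ _ _)) => //.
- exact: repr_H.
- by rewrite size_map.
- exact: size_code.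
Qed.

Lemma rle_access_correct a c l b o : rs = a ++ (c, l) :: b -> o < l ->
  returns (rle_access st (sumn (lens a) + o)) (fun h => h = Some c) (5%:R * T)%R.
Proof.
move=> rsE ol; rewrite /rle_access.
by apply: (bindT (all_rank_correct rsE ol)) => // _ ->; exact: (head_at_correct rsE).
Qed.

(** The occurrences of [c] before [i] are the earlier runs of [c] in full, and the offset of [i] in
    its own run if that is a run of [c]. At the end of the string there is no such run. *)
Lemma rle_rank_correct c i : i <= sumn (lens rs) ->
  returns (rle_rank st c i) (fun k => k = str_rank c (expand rs) i) (14%:R * T)%R.
Proof.
rewrite leq_eqVlt => /predU1P[->|/locate_position].
  apply: (bindT all_rank_end_correct) => // _ ->.
  have rsE : rs = rs ++ [::] by rewrite cats0.
  apply: (bindT (all_block_start_correct rsE)) => // _ ->.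
  apply: (bindT (H_rank_correct c rsE)) => // _ ->.
  apply: (bindT (V_block_start_correct c rsE)) => // _ ->.
  rewrite eqxx; apply: retT.
  by rewrite -count_expand -size_expand -[X in str_rank _ X _]cats0 str_rank_cat.
case=> a [d [l [b [ o [rsE -> ol]]]]].
apply: (bindT (all_rank_correct rsE ol)) => // _ ->.
apply: (bindT (all_block_start_correct rsE)) => // _ ->.
apply: (bindT (H_rank_correct c rsE)) => // _ ->.
apply: (bindT (V_block_start_correct c rsE)) => // _ ->.
have -> : str_rank c (expand rs) (sumn (lens a) + o)
    = sumn (lens (runs_of c a)) + (d == c) * o.
  have -> : sumn (lens a) + o = size (expand a ++ nseq o d).
    by rewrite size_cat size_nseq size_expand.
  rewrite rsE expand_cat expand_cons -{1}(subnKC (ltnW ol)) nseqD -catA catA.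
  rewrite str_rank_cat count_cat.
  by rewrite count_expand count_nseq.
(* The test [i == s] amounts to [o = 0], when the current run contributes nothing whatever its
   head. *)
case: eqP => [Eo|_].
  by apply: retT; have -> : o = 0 by [lia]; rewrite muln0 addn0.
apply: (bindT (head_at_correct rsE)) => // _ ->; apply: retT.
rewrite (inj_eq (@Some_inj _)) addKn; case: eqP => _; rewrite ?mul1n ?mul0n //.
by rewrite addn0.
Qed.

Lemma rle_select_correct c j : 0 < j <= count_mem c (expand rs) ->
  returns (rle_select st c j) (fun p => p = str_select c (expand rs) j) (10%:R * T)%R.
Proof.
rewrite count_expand => jc; have /locate_occurrence : j.-1 < sumn (lens (runs_of c rs)).
  by lia.
case=> a [l [b [ o [rsE jE ol]]]]; rewrite /rle_select jE.
apply: (bindT (V_rank_correct rsE ol)) => // _ ->.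
apply: (bindT (V_block_start_correct c rsE)) => // _ ->.
apply: (bindT (H_select_correct rsE)) => // _ ->.
apply: (bindT (all_block_start_correct rsE)) => // _ ->.
apply: retT; rewrite addKn rsE expand_cat expand_cons.
have -> : nseq l c = nseq o c ++ c :: nseq (l - o).-1 c.
  by rewrite -[c :: _]/(nseq (l - o).-1.+1 c) -nseqD; congr nseq; lia.
rewrite -catA catA cat_cons str_select_cat //; last 2 first.
- by lia.
- by rewrite count_cat count_expand count_nseq /= eqxx mul1n jE.
by rewrite size_cat size_nseq size_expand.
Qed.

Lemma set_VE c a b a' b' (v : G) : rs = a ++ b ->
  (forall d, d != c -> runs_of d a' = runs_of d a) ->
  (forall d, d != c -> runs_of d b' = runs_of d b) ->
  bits v = gap_bits (lens (runs_of c (a' ++ b'))) ->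
  forall d, bits (set_V (rle_V st) c v d) = gap_bits (lens (runs_of d (a' ++ b'))).
Proof.
move=> rsE aE bE vE d; rewrite ffunE; case: eqP => [->//|/eqP dc].
by rewrite (repr_V st_rs) rsE !runs_of_cat aE // bE.
Qed.

Lemma rle_extend_correct a c l b : rs = a ++ (c, l) :: b ->
  returns (rle_extend st (size a) c) (fun st' => represents st' (a ++ (c, l.+1) :: b))
    (12%:R * T)%R.
Proof.
move=> rsE; have [a0 cb0] := pos rsE.
have l0 : 0 < l by move: cb0 => /= /andP[].
have allE : bits (rle_all st) = gap_bits (lens a ++ l :: lens b).
  by rewrite (repr_all st_rs) rsE lens_cat.
have [VE VN Va0 _] := V_split c rsE.
have insE := gap_bits_insert0 (lens b) a0 l0.
have insVE := gap_bits_insert0 (lens (runs_of c b)) Va0 l0.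
move: VE VN; rewrite runs_of_head /= => VE VN.
apply: (bindT (all_block_start_correct rsE)) => // _ ->.
apply: (bindT (unitT (supports_insert supG all_dom (b := false) _ _))) => //.
- by rewrite allE gap_bits_cat size_cat size_gap_bits // leq_addr.
- by rewrite allE insE gapN //; move: rsN; rewrite rsE !size_cat /= !size_map.
move=> va vaE; apply: (bindT (H_rank_correct c rsE)) => // _ ->.
apply: (bindT (V_block_start_correct c rsE)) => // _ ->.
apply: (bindT (unitT (supports_insert supG (V_dom c) (b := false) _ _))) => //.
- by rewrite VE gap_bits_cat size_cat size_gap_bits // leq_addr.
- by rewrite VE insVE gapN //; move: VN; rewrite !size_cat.
move=> vc vcE; apply: retT; split=> /=.
- by move: cb0; rewrite lens_cat all_cat a0 /= => /andP[].
- by rewrite (repr_len st_rs) rsE !lens_cat !sumn_cat /= addnS.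
- by have := repr_H st_rs; rewrite rsE !map_cat.
- by rewrite vaE allE insE lens_cat.
- apply: (set_VE rsE) => // [d|]; first by move=> dc; rewrite !runs_of_other.
  by rewrite vcE VE insVE runs_of_cat lens_cat runs_of_head.
Qed.

Lemma rle_new_run_correct a c b : rs = a ++ b -> size rs < N ->
  returns (rle_new_run st (size a) (sumn (lens a)) c)
    (fun st' => represents st' (a ++ (c, 1) :: b)) (11%:R * T)%R.
Proof.
move=> rsE rsN'; have [a0 b0] := pos rsE.
have allE : bits (rle_all st) = gap_bits (lens a ++ lens b).
  by rewrite (repr_all st_rs) rsE lens_cat.
have [VE _ Va0 _] := V_split c rsE.
have VN : size (lens (runs_of c a) ++ 1 :: lens (runs_of c b)) <= N.
  rewrite size_cat /= addnS -size_cat -lens_cat -runs_of_cat -rsE size_map size_filter.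
  exact: leq_ltn_trans (count_size _ _) rsN'.
have insE := gap_bits_insert1 (lens b) a0.
have insVE := gap_bits_insert1 (lens (runs_of c b)) Va0.
apply: (bindT (unitT (supports_insert supG all_dom (b := true) _ _))) => //.
- by rewrite allE gap_bits_cat size_cat size_gap_bits // leq_addr.
- by rewrite allE insE gapN // size_cat /= addnS -size_cat -lens_cat -rsE size_map.
move=> va vaE; apply: (bindT (H_rank_correct c rsE)) => // _ ->.
apply: (bindT (V_block_start_correct c rsE)) => // _ ->.
apply: (bindT (unitT (supports_insert supG (V_dom c) (b := true) _ _))) => //.
- by rewrite VE gap_bits_cat size_cat size_gap_bits // leq_addr.
- by rewrite VE insVE gapN.
move=> vc vcE; apply: (bindT (H_insert_correct c rsE rsN')) => // t tE.
apply: retT; split=> //=.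
- by rewrite lens_cat all_cat a0.
- by rewrite (repr_len st_rs) rsE !lens_cat !sumn_cat /= add1n addnS.
- by rewrite vaE allE insE lens_cat.
- apply: (set_VE rsE) => // [d|]; first by move=> dc; rewrite !runs_of_other.
  by rewrite vcE VE insVE runs_of_cat lens_cat runs_of_head.
Qed.

(** The two halves are adjacent runs of the same letter, so the result is no longer the maximal
    decomposition, only a list of runs that is represented. *)
Lemma rle_split_correct a d l b o : rs = a ++ (d, l) :: b -> size rs < N -> 0 < o < l ->
  returns (rle_split st (size a) (sumn (lens a)) (sumn (lens a) + o) d)
    (fun st' => represents st' (a ++ (d, o) :: (d, l - o) :: b)) (15%:R * T)%R.
Proof.
move=> rsE rsN' ol; have [a0 db0] := pos rsE.
have allE : bits (rle_all st) = gap_bits (lens a ++ l :: lens b).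
  by rewrite (repr_all st_rs) rsE lens_cat.
have [VE VN Va0 _] := V_split d rsE.
move: VE VN; rewrite runs_of_head /= => VE VN.
have {}VN : size (lens (runs_of d a) ++ l :: lens (runs_of d b)) < N.
  have -> : lens (runs_of d a) ++ l :: lens (runs_of d b) = lens (runs_of d rs).
    by rewrite rsE runs_of_cat lens_cat runs_of_head.
  by rewrite size_map size_filter; exact: leq_ltn_trans (count_size _ _) rsN'.
have [lt_all nth_all] := gap_bits_split_bit (lens b) a0 ol.
have [lt_V nth_V] := gap_bits_split_bit (lens (runs_of d b)) Va0 ol.
have splE := gap_bits_split (lens b) a0 ol.
have splVE := gap_bits_split (lens (runs_of d b)) Va0 ol.
have sz_all : size (lens a ++ l :: lens b) < N.
  by move: rsN'; rewrite rsE !size_cat /= !size_map.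
case/andP: (all_dom) => all_form all_ones; case/andP: (V_dom d) => V_form V_ones.
apply: (bindT (unitT (supG_delete all_form all_ones _ _))) => //; rewrite ?allE //.
move=> va0 va0E.
apply: (bindT (unitT (supports_insert supG _ (b := true) _ _))) => //.
- rewrite va0E gap_form_split_delete // ones_split_delete //.
  by move: sz_all; rewrite size_cat /= addnS => /ltnW.
- by rewrite va0E size_split_delete.
- by rewrite va0E splE gapN //; move: sz_all; rewrite !size_cat /= !addnS.
move=> va vaE; apply: (bindT (H_rank_correct d rsE)) => // _ ->.
apply: (bindT (V_block_start_correct d rsE)) => // _ ->; rewrite addKn.
apply: (bindT (unitT (supG_delete V_form V_ones _ _))) => //; rewrite ?VE //.
move=> vd0 vd0E.
apply: (bindT (unitT (supports_insert supG _ (b := true) _ _))) => //.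
- rewrite vd0E gap_form_split_delete // ones_split_delete //.
  by move: VN; rewrite size_cat /= addnS => /ltnW.
- by rewrite vd0E size_split_delete.
- by rewrite vd0E splVE gapN //; move: VN; rewrite !size_cat /= !addnS.
move=> vd vdE; apply: (bindT (H_insert_correct d rsE rsN')) => // t tE.
apply: retT; split=> //=.
- move: db0; rewrite lens_cat all_cat a0 /= => /andP[_ ->].
  by rewrite subn_gt0 andbT.
- rewrite (repr_len st_rs) rsE !lens_cat !sumn_cat /=.
  by case/andP: ol => _ /ltnW ol; rewrite [X in _ = _ + X]addnA subnKC.
(* Heads ignore lengths: inserting a second copy of the code of [d] in front of the old one gives
   the heads of both halves. *)
- by move: tE; rewrite !map_cat.
- by rewrite vaE va0E splE lens_cat.
- apply: (set_VE rsE) => // [e|]; first by move=> ed; rewrite !runs_of_other.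
  by rewrite vdE vd0E splVE runs_of_cat lens_cat !runs_of_head.
Qed.

End Primitives.

(** * Insertion into the string *)

Lemma str_insert_run a c l b o d : o <= l ->
  str_insert (expand (a ++ (c, l) :: b)) (sumn (lens a) + o) d
  = expand a ++ nseq o c ++ d :: nseq (l - o) c ++ expand b.
Proof.
move=> ol; have -> : sumn (lens a) + o = size (expand a ++ nseq o c).
  by rewrite size_cat size_nseq size_expand.
rewrite expand_cat expand_cons -{1}(subnKC ol) nseqD -catA catA.
by rewrite str_insert_cat -catA.
Qed.

(** A position is the end of the string, inside or at the start of a run of [c], at the start of
    another run, or strictly inside another run. The last case creates two runs, hence the room for
    [(nruns S).+2]. *)
Lemma rle_insert_correct st (S : seq Sigma) i c : rle_repr st S ->
  (nruns S).+2 <= N -> i <= size S ->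
  returns (rle_insert st i c) (fun st' => rle_repr st' (str_insert S i c))
    (40%:R * T)%R.
Proof.
move=> /rle_reprE st_rs SN iS.
have SE : expand (runs S) = S := runsK S.
have mrs : maximal (runs S) := runs_maximal S.
have lenE := repr_len st_rs; have rs0 := repr_pos st_rs.
move: iS; rewrite -{1}SE size_expand -[in str_insert _ _ _]SE.
rewrite /nruns in SN.
move: (runs S) st_rs SN mrs lenE rs0 => rs st_rs SN mrs lenE rs0 irs.
have rsN : size rs <= N by lia.
have rsN' : size rs < N by lia.
have finish st' S' rs' : represents st' rs' -> maximal rs' -> expand rs' = S' ->
    rle_repr st' S'.
  move=> st'_rs' m <-; apply/rle_reprE; rewrite runs_expand //.
  exact: repr_pos st'_rs'.
(* The offset [o = l] is allowed: it is the case where [c] is appended to the run that ends just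
   before position [i]. *)
have extend a l b o k : rs = a ++ (c, l) :: b -> o <= l -> i = sumn (lens a) + o ->
    12 <= k ->
    returns (rle_extend st (size a) c)
      (fun st' => rle_repr st' (str_insert (expand rs) i c)) (k%:R * T)%R.
  move=> rsE ol iE k12; apply: (weakT (rle_extend_correct st_rs rsN rsE)) => // st' st'_rs.
  apply: (finish _ _ _ st'_rs).
    by apply: (@maximal_extend _ _ _ l); rewrite -rsE.
  rewrite rsE iE str_insert_run // expand_cat expand_cons; congr (_ ++ _).
  by rewrite -[c :: _]/(nseq (l - o).+1 c ++ _) catA -nseqD; congr (nseq _ _ ++ _); lia.
(* This covers both the end of the string and the start of a run of another letter: the preceding
   run is lengthened if its head is [c], and otherwise a run is created between two heads other than
   [c]. *)
have boundary a b : rs = a ++ b -> i = sumn (lens a) ->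
    (forall d m b', b = (d, m) :: b' -> d != c) ->
    returns
      (let! h' := if 0 < size a then head_at Sigma (rle_H st) (size a).-1 else ret None in
       if h' == Some c then rle_extend st (size a).-1 c else rle_new_run st (size a) i c)
      (fun st' => rle_repr st' (str_insert (expand rs) i c)) (31%:R * T)%R.
  move=> rsE iE hb.
  have [ma mb] : maximal a /\ maximal b by apply: maximal_cat; rewrite -rsE.
  have new : (forall a' d m, a = rcons a' (d, m) -> d != c) ->
      returns (rle_new_run st (size a) i c)
        (fun st' => rle_repr st' (str_insert (expand rs) i c)) (27%:R * T)%R.
    move=> ha; rewrite iE.
    apply: (weakT (rle_new_run_correct st_rs rsN c rsE rsN')) => // st' st'_rs.
    apply: (finish _ _ _ st'_rs); first exact: maximal_insert.
    by rewrite rsE !expand_cat -size_expand str_insert_cat.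
  case/lastP: a rsE iE new {ma} => [|a [d l]] rsE iE new.
    apply: (@bindT _ _ _ _ (fun h => h = None) _ 3); rewrite ?size_rcons //=.
      exact: retT.
    by move=> _ -> /=; apply: new => a' d m; case: a'.
  rewrite cat_rcons in rsE; rewrite size_rcons /= -(size_rcons a (d, l)).
  apply: (bindT (head_at_correct st_rs rsN rsE)) => // _ ->.
  case: eqP => [[dc]|/eqP dc].
    rewrite {}dc in rsE iE; apply: (extend a l b l _ rsE) => //.
    by rewrite iE -cats1 lens_cat sumn_cat /= addn0.
  by apply: new => a' d' m /rcons_inj[_ <- _]; apply: contra dc => /eqP->.
rewrite /rle_insert; move: (irs); rewrite leq_eqVlt => /predU1P[iE|/locate_position].
  have rsE : rs = rs ++ [::] by rewrite cats0.
  rewrite {1 2}iE; apply: (bindT (all_rank_end_correct st_rs rsN)) => // _ ->.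
  apply: (bindT (all_block_start_correct st_rs rsN rsE)) => // _ ->.
  rewrite lenE -iE ltnn.
  apply: (@bindT _ _ _ _ (fun h => h = None) _ 3); rewrite ?iE //; first exact: retT.
  by move=> _ -> /=; rewrite eqxx -iE; apply: (boundary _ _ rsE).
case=> a [d [l [b [ o [rsE iE ol]]]]].
rewrite [in bv_rank _ _ _]iE.
apply: (bindT (all_rank_correct st_rs rsN rsE ol)) => // _ ->.
apply: (bindT (all_block_start_correct st_rs rsN rsE)) => // _ ->.
have -> : i < rle_len st by rewrite lenE rsE lens_cat sumn_cat /= iE; lia.
apply: (bindT (head_at_correct st_rs rsN rsE)) => // _ ->.
case: eqP => [[dc]|/eqP dc].
  rewrite {}dc in rsE; exact: (extend a l b o _ rsE (ltnW ol) iE).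
case: eqP => [i0|i0].
  apply: (boundary _ _ rsE i0) => d' m b' [<- _ _].
  by apply: contra dc => /eqP->.
(* The position cuts a run of [d]. After the split the new run of [c] goes between the two halves,
   which makes adjacent heads distinct again. *)
have ol' : 0 < o < l by rewrite ol andbT; lia.
rewrite /= iE; apply: (bindT (rle_split_correct st_rs rsN rsE rsN' ol')) => // st' st'_rs.
set rs' := a ++ _ in st'_rs.
have rs'E : rs' = rcons a (d, o) ++ (d, l - o) :: b by rewrite cat_rcons.
have sz' : size rs' = (size rs).+1 by rewrite /rs' rsE !size_cat /= !addnS.
have -> : sumn (lens a) + o = sumn (lens (rcons a (d, o))).
  by rewrite -cats1 lens_cat sumn_cat /= addn0.
rewrite -(size_rcons a (d, o)).
apply: (weakT (rle_new_run_correct st'_rs _ c rs'E _)); rewrite ?sz' // => st'' st''_rs.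
apply: (finish _ _ _ st''_rs).
  rewrite rsE in mrs; have [ma mb] := maximal_cat mrs.
  apply: maximal_insert => //.
  - rewrite -cats1; apply: (proj1 (maximal_cat (b := b) _)).
    by rewrite -catA; apply: maximal_extend mrs.
  - exact: (@maximal_extend _ [::] _ l).
  - by move=> a' d' m /rcons_inj[_ <- _]; apply: contra dc => /eqP->.
  - by move=> d' m b' [<- _ _]; apply: contra dc => /eqP->.
rewrite -cats1 lens_cat sumn_cat /= addn0 rsE str_insert_run; last exact: ltnW.
by rewrite !expand_cat -!catA.
Qed.

End RleOperations.

(** * Logarithms and limits *)

Section Logarithms.
Variable R : realType.
Local Open Scope ring_scope.
Local Notation log2 := (@log2 R).
Local Notation lg := (lg R).
Implicit Types (x y : R) (m n : nat).

Lemma ln2_gt0 : 0 < ln 2 :> R.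
Proof. by rewrite ln_gt0 // ltr1n. Qed.

Lemma ln_le_subr1 x : 0 < x -> ln x <= x - 1.
Proof. by move=> x0; have := @le_ln1Dx R (x - 1); rewrite subrKC; apply; lra. Qed.

Lemma log2M x y : 0 < x -> 0 < y -> log2 (x * y) = log2 x + log2 y.
Proof. by move=> x0 y0; rewrite /Defs.log2 lnM ?posrE // mulrDl. Qed.

Lemma log2_div x y : 0 < x -> 0 < y -> log2 (x / y) = log2 x - log2 y.
Proof. by move=> x0 y0; rewrite /Defs.log2 ln_div ?posrE // mulrBl. Qed.

Lemma log2_2X n : log2 (2 ^+ n) = n%:R.
Proof. by rewrite /Defs.log2 lnXn // -[ln _ *+ _]mulr_natl mulfK // gt_eqF // ln2_gt0. Qed.

Lemma log2_2 : log2 2 = 1.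
Proof. exact: (log2_2X 1). Qed.

Lemma le_log2 x y : 0 < x -> x <= y -> log2 x <= log2 y.
Proof.
move=> x0 xy; rewrite ler_pM2r ?invr_gt0 ?ln2_gt0 // ler_ln // posrE //.
exact: lt_le_trans xy.
Qed.

Lemma log2_ge0 x : 1 <= x -> 0 <= log2 x.
Proof. by move=> x1; rewrite divr_ge0 ?ln_ge0 ?ler1n. Qed.

Lemma lg_ge1 n : 1 <= lg n.
Proof. by rewrite le_max lexx. Qed.

Lemma lg_gt0 n : 0 < lg n.
Proof. exact: lt_le_trans (lg_ge1 n). Qed.

Lemma log2_le_lg n : log2 n%:R <= lg n.
Proof. by rewrite le_max lexx orbT. Qed.

Lemma lgE n : (2 <= n)%N -> lg n = log2 n%:R.
Proof.
by move=> n2; apply/max_idPr; rewrite -[leLHS]log2_2 le_log2 ?ler_nat.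
Qed.

Lemma le_lg m n : (m <= n)%N -> lg m <= lg n.
Proof.
case: m => [|m] mn.
  by rewrite {1}/Defs.lg /Defs.log2 ln0 // mul0r max_l // lg_ge1.
rewrite ge_max lg_ge1 /=; apply: le_trans (log2_le_lg n).
by rewrite le_log2 ?ltr0n ?ler_nat.
Qed.

(** From [n + 2 <= 4 * maxn 1 n]. This absorbs the growth to [r + 2] runs during an insertion. *)
Lemma lgSS_le n : lg n.+2 <= 3 * lg n.
Proof.
have h : log2 n.+2%:R <= 2 + log2 (maxn 1 n)%:R.
  rewrite -(log2_2X 2) -log2M ?ltr0n ?exprn_gt0 ?leq_maxl ?leq_max //.
  rewrite le_log2 ?ltr0n // -natrX -natrM ler_nat; lia.
rewrite lgE //; apply: le_trans h _; have := lg_ge1 n.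
have := log2_le_lg n; case: n => [|n]; last by rewrite maxnE subnKC // => *; lra.
by rewrite /= {2}/Defs.log2 ln1 mul0r; lra.
Qed.

Lemma log2_lg_ge0 n : 0 <= log2 (lg n).
Proof. exact/log2_ge0/lg_ge1. Qed.

(** For [x >= 1], [ln x <= x / 2 - 1 + ln 2], and this is at most [x * ln 2] because
    [ln 2 >= 1 / 2]. *)
Lemma log2_lg_le n : log2 (lg n) <= lg n.
Proof.
set x := lg n; have x1 : 1 <= x := lg_ge1 n.
have l2 : 2^-1 <= ln 2 :> R.
  have := @ln_le_subr1 (2^-1); rewrite lnV ?posrE // => /(_ _); lra.
have := @ln_le_subr1 (x / 2); rewrite ln_div ?posrE //; last by lra.
have x20 : 0 < x / 2 by lra.
move=> /(_ x20) h; rewrite ler_pdivrMr ?ln2_gt0 //; nra.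
Qed.

Lemma nat_le_log2 d n : (2 ^ d <= n)%N -> d%:R <= log2 n%:R.
Proof.
move=> dn; by rewrite -[leLHS]log2_2X le_log2 ?exprn_gt0 // -natrX ler_nat.
Qed.

Lemma word_size_le n : (word_size n)%:R <= 2 * lg n.
Proof.
rewrite /word_size -natr1; have := lg_ge1 n; case: n => [|n].
  by rewrite trunc_log0; lra.
have := nat_le_log2 (@trunc_logP 2 n.+1 isT isT).
by have := log2_le_lg n.+1; lra.
Qed.

Section Alphabet.
Variable Sigma : finType.
Hypothesis Sigma0 : (0 < #|Sigma|)%N.

Lemma expn_code_len : (2 ^ code_len Sigma <= 2 * #|Sigma|)%N.
Proof.
rewrite /code_len; move: Sigma0; case: #|Sigma| => [|[|n]] // _.
have := @up_log_gtn 2 n.+2 isT isT; have := up_log_gt0 2 n.+2.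
by case: (up_log 2 n.+2) => // d _ /= ?; rewrite expnS; lia.
Qed.

Lemma code_len_le_log2 : (code_len Sigma)%:R <= log2 #|Sigma|%:R + 1.
Proof.
have := nat_le_log2 expn_code_len; rewrite natrM log2M ?ltr0n // log2_2; lra.
Qed.

Lemma code_len_le_lg : (code_len Sigma)%:R <= 2 * lg #|Sigma|.
Proof.
have := code_len_le_log2; have := log2_le_lg #|Sigma|; have := lg_ge1 #|Sigma|.
lra.
Qed.

End Alphabet.

(* Gibbs' inequality, from ln x <= x - 1.  Terms with r i = 0 vanish whatever
   the junk value of the quotient. *)
Lemma sum_log2_div_le (I : finType) (n r : I -> nat) : (forall i, (r i <= n i)%N) ->
  \sum_i (r i)%:R * log2 ((n i)%:R / (r i)%:R)
  <= (\sum_i r i)%:R * log2 ((\sum_i n i)%:R / (\sum_i r i)%:R).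
Proof.
move=> rn; set rt := (\sum_i r i)%N; set nt := (\sum_i n i)%N.
have [rt0|rt0] := posnP rt.
  rewrite rt0 mul0r big1 // => i _; have /eqP := rt0.
  by rewrite sum_nat_eq0 => /forallP/(_ i)/eqP->; rewrite mul0r.
have rtnt : (rt <= nt)%N by exact: leq_sum.
have nt0 : (0 < nt)%N by exact: leq_trans rtnt.
rewrite /Defs.log2 [leRHS]mulrA; under eq_bigr do rewrite mulrA.
rewrite -mulr_suml ler_pM2r ?invr_gt0 ?ln2_gt0 //.
(* The correction terms have sum zero. With them the inequality holds term by term, by
   [ln x <= x - 1] at the quotient of [n i / r i] by [nt / rt]. *)
have -> : rt%:R * ln (nt%:R / rt%:R) =
    \sum_i ((r i)%:R * ln (nt%:R / rt%:R) + (n i)%:R * (rt%:R / nt%:R) - (r i)%:R) :> R.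
  rewrite big_split big_split /= sumrN -!mulr_suml -!natr_sum -/rt -/nt.
  by rewrite mulrCA divff ?pnatr_eq0 -?lt0n // mulr1 addrK.
apply: ler_sum => i _.
have [->|ri0] := posnP (r i).
  by rewrite !mul0r subr0 add0r mulr_ge0 // divr_ge0.
have ni0 := leq_trans ri0 (rn i).
have h : 0 < ((n i)%:R / (r i)%:R) / (nt%:R / rt%:R) :> R.
  by rewrite !divr_gt0 ?ltr0n.
have := ln_le_subr1 h; rewrite ln_div ?posrE ?divr_gt0 ?ltr0n // lerBlDl.
have r0' : 0 < (r i)%:R :> R by rewrite ltr0n.
rewrite -(ler_pM2l r0') => /le_trans; apply; rewrite le_eqVlt; apply/orP; left.
apply/eqP; field; rewrite !pnatr_eq0 -!lt0n ri0 nt0 rt0 //.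
Qed.

End Logarithms.

(** * Vanishing sequences and uniform bounds *)

Section Limits.
Variable R : realType.
Local Open Scope ring_scope.

Lemma cvg0_eventually (u : nat -> R) (e : R) : (u @ \oo --> (0 : R))%classic -> 0 < e ->
  exists n0, forall n, (n0 <= n)%N -> `|u n| < e.
Proof.
move=> /cvgr0Pnorm_lt u0 /u0 [n0 _ Hn0]; exists n0 => n nn0.
exact: Hn0.
Qed.

Lemma norm_le_sum (u : nat -> R) n m : (m < n)%N -> `|u m| <= \sum_(i < n) `|u i|.
Proof.
move=> mn; rewrite (bigD1 (Ordinal mn)) //= lerDl.
by apply: sumr_ge0 => i _.
Qed.

(** The finitely many [m] at which the ratio may exceed [e] are covered by the constant [M]. The
    linear form can be summed over the nodes of a tree. *)
Lemma little_o_linear (f : nat -> R) (e : R) :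
  ((fun m => f m / m%:R) @ \oo --> (0 : R))%classic -> 0 < e ->
  exists M, 0 <= M /\ forall m, f m <= e * m%:R + M.
Proof.
move=> f0 e0; have [n0 Hn0] := cvg0_eventually f0 e0.
exists (\sum_(i < n0.+1) `|f i|); split=> [|m]; first exact: sumr_ge0.
have [mn|mn] := ltnP m n0.+1.
  apply: le_trans (ler_norm _) (le_trans (norm_le_sum _ mn) _).
  by rewrite lerDr mulr_ge0 // ltW.
have m0 : 0 < m%:R :> R by rewrite ltr0n; apply: leq_ltn_trans mn.
apply: le_trans (_ : e * m%:R <= _); last by rewrite lerDl sumr_ge0.
rewrite -ler_pdivrMr //; apply: le_trans (ler_norm _) (ltW (Hn0 _ _)).
exact: ltnW.
Qed.

(* A diagonal argument: eps q is 1/(j+1) for the largest j <= q whose threshold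
   has been passed. *)
Lemma vanishing_choice (P : nat -> R -> Prop) (D : R) : (forall q, P q D) ->
  (forall e, 0 < e -> exists q0, forall q, (q0 <= q)%N -> P q e) ->
  exists eps : nat -> R, (eps @ \oo --> (0 : R))%classic /\ forall q, P q (eps q).
Proof.
move=> PD Pe.
have /choice[q0 Hq0] : forall j : nat, exists q0, forall q, (q0 <= q)%N -> P q j.+1%:R^-1.
  by move=> j; apply: Pe; rewrite invr_gt0 ltr0n.
pose passed q : pred 'I_q.+1 := fun j => (q0 j <= q)%N.
pose top q := (\max_(j in passed q) j)%N.
(* If no threshold has been passed, the maximum is over the empty set, hence 0, whose test fails;
   the value is then [D]. *)
exists (fun q => if (q0 (top q) <= q)%N then (top q).+1%:R^-1 else D); split; last first.
  by move=> q; case: ifP => // /Hq0.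
apply/cvgr0Pnorm_lt => e e0; pose j := Num.bound e^-1.
exists (maxn j (q0 j)) => // q /=; rewrite geq_max => /andP[jq qj].
have jq1 : (j < q.+1)%N by [].
have jP : Ordinal jq1 \in passed q by [].
have [|i iP topE] := @eq_bigmax_cond _ (mem (passed q)) (fun j : 'I_q.+1 => nat_of_ord j).
  by apply/card_gt0P; exists (Ordinal jq1).
have jtop : (j <= top q)%N.
  exact: (@leq_bigmax_cond _ (mem (passed q)) (fun j : 'I_q.+1 => nat_of_ord j) _ jP).
have -> : (q0 (top q) <= q)%N by rewrite /top topE.
rewrite gtr0_norm ?invr_gt0 ?ltr0n // invf_plt ?posrE ?ltr0n //.
apply: lt_le_trans (archi_boundP _) _; first by rewrite invr_ge0 ltW.
by rewrite ler_nat ltnW.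
Qed.

End Limits.

(** * Space *)

Section Space.
Variable R : realType.
Local Open Scope ring_scope.
Local Notation log2 := (@log2 R).
Local Notation lg := (lg R).

(** For [k = 0] the quotient is 0 by default, and so is its logarithm. *)
Lemma log2_nat_div_ge0 (n k : nat) : (k <= n)%N -> 0 <= log2 (n%:R / k%:R).
Proof.
move=> kn; have [->|k0] := posnP k; first by rewrite invr0 mulr0 /Defs.log2 ln0 ?mul0r.
by apply: log2_ge0; rewrite ler_pdivlMr ?ltr0n // mul1r ler_nat.
Qed.

(* log n / log k = log (n/k) / log k + 1: the last summand is constant and the
   other one is o(log (n/k)), up to O(log n) for the finitely many small k. *)
Lemma gap_space_bound_le (C : R) (eps : nat -> R) (e : R) :
  (eps @ \oo --> (0 : R))%classic -> 0 < e ->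
  exists M, 0 <= M /\ forall n k, (k <= n)%N ->
    gap_space_bound C eps n k <=
    2 * k%:R * (log2 (n%:R / k%:R) + log2 (lg k) + `|C|) * (1 + e) + M * lg n.
Proof.
move=> eps0 e0; set c := `|C|; have c0 : 0 <= c := normr_ge0 _.
(* With [e1 <= 1 / 3], [(1 + e1) ^ 2 <= 1 + 3 * e1 <= 1 + e]: one factor pays for [eps k], the other
   for [c / log k]. *)
pose e1 := Num.min e 1 / 3.
have e10 : 0 < e1 by rewrite divr_gt0 // lt_min e0 ltr01.
have e11 : (1 + e1) * (1 + e1) <= 1 + e.
  have : Num.min e 1 <= e by rewrite ge_min lexx.
  have : Num.min e 1 <= 1 by rewrite ge_min lexx orbT.
  have -> : Num.min e 1 = 3 * e1 by rewrite /e1; field.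
  by nra.
have [k0 Hk0] := cvg0_eventually eps0 e10.
(* From [k1] on, both [eps k] and [c / log k] are at most [e1]. *)
pose k1 := maxn k0 (2 ^ Num.bound (c / e1)).
pose E := \sum_(i < k1) `|eps i|.
have E0 : 0 <= E by exact: sumr_ge0.
(* The first summand covers [k <= 1]. The second covers [k < k1], where [x], [ll] and [x / L] are
   each at most [lg n]. *)
pose M := c + 2 * k1%:R * (2 + 2 * c) * (1 + E).
have k10 : 0 <= k1%:R :> R by [].
have M0 : 0 <= M by rewrite addr_ge0 // !mulr_ge0 // addr_ge0 // mulr_ge0.
exists M; split=> // n k kn.
set x := log2 _; set ll := log2 (lg k).
have x0 : 0 <= x := log2_nat_div_ge0 kn.
have ll0 : 0 <= ll := log2_lg_ge0 R k.
have n1 : 1 <= lg n := lg_ge1 R n.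
have X0 : 0 <= 2 * k%:R * (x + ll + c) by rewrite !mulr_ge0 // !addr_ge0.
have Xe0 : 0 <= 2 * k%:R * (x + ll + c) * (1 + e).
  by rewrite mulr_ge0 // addr_ge0 // ltW.
have Mn0 : 0 <= M * lg n by rewrite mulr_ge0 // (le_trans _ n1).
rewrite /gap_space_bound; case: leqP => k2.
  have : C * lg n <= c * lg n by rewrite ler_wpM2r ?ler_norm // (le_trans _ n1).
  have : c * lg n <= M * lg n.
    rewrite ler_wpM2r ?(le_trans _ n1) // lerDl !mulr_ge0 // addr_ge0 //.
    by rewrite mulr_ge0.
  by lra.
have k0' : 0 < k%:R :> R by rewrite ltr0n; exact: ltnW.
have n0' : 0 < n%:R :> R by rewrite ltr0n; apply: leq_trans kn; exact: ltnW.
rewrite -(lgE _ k2) -/x -/ll; set L := lg k; have L1 : 1 <= L := lg_ge1 R k.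
have L0 : 0 < L by lra.
have -> : log2 n%:R = x + L by rewrite /x /L lgE // log2_div // subrK.
have -> : (x + L) / L = x / L + 1 by rewrite mulrDl divff // gt_eqF.
have xL0 : 0 <= x / L by rewrite divr_ge0 // ltW.
have step : 2 * k%:R * (x + ll + C * (x / L + 1)) * (1 + eps k)
    <= 2 * k%:R * (x + ll + c * (x / L + 1)) * (1 + `|eps k|).
  apply: le_trans (ler_norm _) _; rewrite normrM; apply: ler_pM => //.
    rewrite normrM ger0_norm ?mulr_ge0 // ler_wpM2l ?mulr_ge0 //.
    apply: le_trans (ler_normD _ _) _; rewrite ger0_norm ?addr_ge0 // lerD2l.
    by rewrite normrM [X in _ * X]ger0_norm // addr_ge0.
  by apply: le_trans (ler_normD _ _) _; rewrite normr1.
apply: le_trans step _; have [kk1|kk1] := leqP k1 k.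
  have epsk : `|eps k| <= e1 by apply/ltW/Hk0/(leq_trans _ kk1); rewrite leq_maxl.
  have cL : c <= e1 * L.
    rewrite mulrC -ler_pdivrMr //; apply: le_trans (ltW (archi_boundP _)) _.
      by rewrite divr_ge0 // ltW.
    rewrite /L lgE //; apply: nat_le_log2; apply: leq_trans kk1; exact: leq_maxr.
  have cxL : c * (x / L) <= e1 * x.
    by rewrite mulrCA mulrC ler_wpM2r // ler_pdivrMr.
  apply: le_trans (_ : 2 * k%:R * ((x + ll + c) * (1 + e1)) * (1 + e1) <= _).
    apply: ler_pM; last by rewrite lerD2l.
    - by rewrite !mulr_ge0 // !addr_ge0 // mulr_ge0 // addr_ge0.
    - by rewrite addr_ge0.
    - rewrite ler_wpM2l ?mulr_ge0 //.
      have := mulr_ge0 (ltW e10) ll0; have := mulr_ge0 (ltW e10) c0.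
      by move: cxL; set u := x / L; lra.
  rewrite -!mulrA mulrA [X in _ <= X + _]mulrA -[leLHS]addr0 lerD //.
  by rewrite mulrA [leRHS]mulrA ler_wpM2l // !mulr_ge0 // !addr_ge0.
have epsk : `|eps k| <= E := norm_le_sum eps kk1.
have xn : x <= lg n.
  rewrite /x log2_div //; have := log2_le_lg R n; have := log2_ge0 (_ : 1 <= k%:R :> R).
  by rewrite ler1n => /(_ (ltnW k2)); lra.
have lln : ll <= lg n by exact: le_trans (log2_lg_le R k) (le_lg R kn).
have xLn : x / L <= lg n.
  by apply: le_trans xn; rewrite ler_pdivrMr // ler_peMr.
apply: le_trans (_ : 2 * k1%:R * ((2 + 2 * c) * lg n) * (1 + E) <= _).
  have y0 : 0 <= x + ll + c * (x / L + 1).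
    by rewrite !addr_ge0 // mulr_ge0 // addr_ge0.
  apply: ler_pM; last by rewrite lerD2l.
  - by rewrite !mulr_ge0.
  - by rewrite addr_ge0.
  - apply: ler_pM; rewrite ?mulr_ge0 //; first by rewrite ler_pM2l // ler_nat ltnW.
    by have := ler_wpM2l c0 xLn; have := ler_wpM2l c0 n1; set u := x / L; lra.
apply: le_trans (_ : M * lg n <= _); last by rewrite lerDr.
have : 0 <= c * lg n by rewrite mulr_ge0 // (le_trans _ n1).
by rewrite /M; lra.
Qed.

Lemma wt_nodesE (B : dyn_bv) d (t : wtree B) X : wt_repr d t X ->
  (wt_nodes t).+1 = (2 ^ d.+1)%N.
Proof.
elim: d t X => [|d IH] [|v l r] X //= [_ /IH El /IH Er].
by rewrite expnS; lia.
Qed.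

(** The bitvectors of one level partition the words, so their lengths add up to [size X]; the
    additive constant is paid once per node. *)
Lemma wt_bits_space_le (B : dyn_bv) (f : nat -> R) (e M : R) d (t : wtree B) X :
  0 <= M ->
  (forall v : B, (bv_space v)%:R <= (size (bits v))%:R + f (size (bits v))) ->
  (forall m, f m <= e * m%:R + M) -> wt_repr d t X ->
  (wt_bits_space t)%:R <= (1 + e) * (d%:R * (size X)%:R) + M * (wt_nodes t)%:R.
Proof.
move=> M0 spB fM; elim: d t X => [|d IH] [|v l r] X //=.
  by move=> _; rewrite mul0r mulr0 add0r mulr1.
move=> [vX /IH Hl /IH Hr].
have vsp := spB v; rewrite vX size_map in vsp.
have vf := fM (size X).
have sizeE : (size X)%:R =
    (size [seq behead w | w <- X & ~~ head false w])%:R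
    + (size [seq behead w | w <- X & head false w])%:R :> R.
  by rewrite -natrD !size_map !size_filter addnC (count_predC (head false)).
rewrite -!natr1 !natrD; rewrite sizeE in vsp vf *; lra.
Qed.

Lemma size_lens_runs (T : eqType) (S : seq T) : sumn (lens (runs S)) = size S.
Proof. by rewrite -size_expand -[in RHS](runsK S). Qed.

Lemma size_le_sumn (l : seq nat) : all (leq 1) l -> (size l <= sumn l)%N.
Proof. by elim: l => //= x l IH /andP[x1 /IH]; lia. Qed.

Lemma sumn_runs_of (Sigma : finType) (rs : seq (Sigma * nat)) :
  (\sum_c sumn (lens (runs_of c rs)))%N = sumn (lens rs) /\
  (\sum_c size (runs_of c rs))%N = size rs.
Proof.
elim: rs => [|[d l] rs [IHl IHs]]; first by rewrite !big1.
have E c : runs_of c ((d, l) :: rs)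
    = if d == c then (d, l) :: runs_of c rs else runs_of c rs by [].
split; under eq_bigr do rewrite E.
  rewrite (eq_bigr (fun c => (if d == c then l else 0) + sumn (lens (runs_of c rs))))%N.
    by rewrite big_split /= IHl -big_mkcond (big_pred1 d) // => c; rewrite eq_sym.
  by move=> c _; case: eqP.
rewrite (eq_bigr (fun c => (if d == c then 1 else 0) + size (runs_of c rs)))%N.
  by rewrite big_split /= IHs -big_mkcond (big_pred1 d) // => c; rewrite eq_sym.
by move=> c _; case: eqP.
Qed.

Variables (G : gap_bv) (B : dyn_bv) (K : nat).
Hypotheses (hG : gap_encoded R G) (hB : succinct R B).

(** The constant [C] in the main term is chosen before [e]; only the factor [M] of the alphabet term
    depends on [e]. *)
Lemma rle_space_le : exists C : R, 0 <= C /\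
  forall e, 0 < e -> exists M, 0 <= M /\
  forall Sigma : finType, (0 < #|Sigma|)%N ->
  forall (st : rle_str G B Sigma) (S : seq Sigma), rle_repr st S ->
    (rle_space K st)%:R <=
      (1 + e) * ((nruns S)%:R * (4 * log2 ((size S)%:R / (nruns S)%:R)
                   + log2 #|Sigma|%:R + 4 * log2 (lg (nruns S)) + C))
      + M * (#|Sigma|%:R * lg (size S)).
Proof.
have [C [eps [eps0 spG]]] := gap_space hG; have [f [f0 spB]] := succinct_space hB.
(* [V_all] and the family of the [V_c] contribute twice the constant each; the 1 comes from rounding
   the code length up. *)
exists (4 * `|C| + 1); split=> [|e e0]; first by rewrite addr_ge0 // mulr_ge0.
have [M1 [M10 HM1]] := gap_space_bound_le C eps0 e0.
have [M2 [M20 HM2]] := little_o_linear f0 e0.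
(* [2 * M1] is for [V_all] and the [V_c], [4 * M2] for the at most [4 * s] nodes, and the rest for
   the topology and pointers, in words of at most [2 * lg n] bits. *)
exists (2 * M1 + 4 * M2 + 8 * K%:R + 8); split=> [|Sigma Sigma0 st S].
  by rewrite !addr_ge0 // mulr_ge0.
move=> /rle_reprE[rs0 lenE HE allE VE]; set n := size S; set r := nruns S.
set s : R := #|Sigma|%:R; have s1 : 1 <= s by rewrite ler1n.
have n1 : 1 <= lg n := lg_ge1 R n.
have nE : sumn (lens (runs S)) = n := size_lens_runs S.
have rn : (r <= n)%N by rewrite -nE -[r](size_map snd); exact: size_le_sumn.
have gap_le (v : G) l : bits v = gap_bits l -> all (leq 1) l ->
    (bv_space v)%:R <= 2 * (size l)%:R * (log2 ((sumn l)%:R / (size l)%:R)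
       + log2 (lg (size l)) + `|C|) * (1 + e) + M1 * lg (sumn l).
  move=> vE l0; have := spG v; rewrite vE gap_form_gap_bits size_gap_bits //.
  rewrite ones_gap_bits => /(_ isT)/le_trans; apply; apply: HM1.
  exact: size_le_sumn.
have sp_all := gap_le _ _ allE rs0; rewrite nE size_map -/r in sp_all.
have sp_V : (\sum_c bv_space (rle_V st c))%:R <=
    2 * r%:R * (log2 (n%:R / r%:R) + log2 (lg r) + `|C|) * (1 + e) + M1 * (s * lg n).
  rewrite natr_sum.
  pose nc c := sumn (lens (runs_of c (runs S))).
  pose rc c := size (runs_of c (runs S)).
  have [ncE rcE] := sumn_runs_of (runs S).
  have rnc c : (rc c <= nc c)%N.
    by rewrite /rc -(size_map snd); exact/size_le_sumn/all_lens_runs_of.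
  have ncn c : (nc c <= n)%N by rewrite -nE -ncE (bigD1 c) //= leq_addr.
  have rcr c : (rc c <= r)%N by rewrite /r /nruns -rcE (bigD1 c) //= leq_addr.
  (* The terms [log2 (lg (rc c))] and [lg (nc c)] are replaced by their values for the whole string,
     so that only the quotients depend on [c]; Gibbs' inequality handles these. *)
  apply: le_trans (_ : \sum_c (2 * (1 + e) * ((rc c)%:R * log2 ((nc c)%:R / (rc c)%:R))
     + 2 * (1 + e) * (log2 (lg r) + `|C|) * (rc c)%:R + M1 * lg n) <= _).
    apply: ler_sum => c _; apply: le_trans (gap_le _ _ (VE c) (all_lens_runs_of c rs0)) _.
    rewrite size_map -/(rc c) -/(nc c); apply: lerD; last first.
      by rewrite ler_wpM2l // le_lg.
    have lle : log2 (lg (rc c)) <= log2 (lg r).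
      by rewrite le_log2 ?lg_gt0 // le_lg.
    have : 0 <= (rc c)%:R * (log2 (lg r) - log2 (lg (rc c))) * (1 + e).
      by rewrite !mulr_ge0 ?subr_ge0 // addr_ge0 // ltW.
    by lra.
  rewrite big_split big_split /= -!mulr_sumr sumr_const -natr_sum /rc rcE.
  rewrite -mulr_natr -/s -/r.
  have := sum_log2_div_le R rnc; rewrite /nc /rc rcE ncE nE -/r => gibbs.
  have : 0 <= (1 + e) * (r%:R * log2 (n%:R / r%:R) -
     \sum_c (rc c)%:R * log2 ((nc c)%:R / (rc c)%:R)).
    by rewrite mulr_ge0 ?subr_ge0 // addr_ge0 // ltW.
  rewrite /nc /rc; lra.
have sp_H := wt_bits_space_le M20 spB HM2 HE; rewrite size_map -/r in sp_H.
have nodes : (wt_nodes (rle_H st))%:R <= 4 * s.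
  rewrite -natrM ler_nat; apply: leq_trans (leqnSn _) _.
  by rewrite (wt_nodesE HE) expnS -[4%N]/(2 * 2)%N -mulnA leq_mul2l expn_code_len.
have dle := code_len_le_log2 R Sigma0; rewrite -/s in dle.
have word := word_size_le R n; rewrite -lenE in nE.
rewrite /rle_space nE !natrD natrM !natrD natrM -/s.
set nd := (wt_nodes _)%:R in sp_H nodes *; set d := (code_len _)%:R in sp_H dle.
set w := (word_size n)%:R in word *; set x := log2 (n%:R / _) in sp_all sp_V *.
have sn : s <= s * lg n by rewrite ler_peMr //; lra.
have h1 : (K%:R * nd + s + 3) * w <= (8 * K%:R + 8) * (s * lg n).
  have -> : (8 * K%:R + 8) * (s * lg n) = (4 * K%:R + 4) * s * (2 * lg n) by ring.
  apply: ler_pM => //; first by rewrite !addr_ge0 ?mulr_ge0.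
  have := ler_wpM2l (ler0n R K) nodes; lra.
have h2 : M2 * nd <= 4 * M2 * (s * lg n).
  have := ler_wpM2l M20 nodes; have := ler_wpM2l M20 sn; lra.
have h3 : M1 * lg n <= M1 * (s * lg n).
  by rewrite ler_wpM2l // ler_peMl //; lra.
have h4 : (1 + e) * (d * r%:R) <= (1 + e) * (r%:R * (log2 s + 1)).
  rewrite [d * _]mulrC ler_wpM2l ?ler_wpM2l //; lra.
lra.
Qed.

(** With [y = r / sigma], [log n] splits into [log (n / r) + log sigma + log y]. The first two are
    handled by [sigma <= e * r], the last by [log y <= e * y]. *)
Lemma sigma_lg_small (e : R) : 0 < e -> exists q0, forall n r sigma,
  (0 < sigma)%N -> (q0 * sigma <= r <= n)%N ->
  sigma%:R * lg n <= e * (r%:R * (log2 (n%:R / r%:R) + log2 sigma%:R + 1)).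
Proof.
(* The value of [e'] comes from [ln x <= x - 1] at [e' * y]: it gives
   [ln y <= 2 * e' * y = e * y * ln 2] as soon as [- ln e' <= e' * y]. *)
move=> e0; have l20 := ln2_gt0 R; pose e' := e * ln 2 / 2.
have e'0 : 0 < e' by rewrite divr_gt0 // mulr_gt0.
pose q0 := maxn 2 (maxn (Num.bound e^-1) (Num.bound `|ln e' / e'|)).
exists q0 => n r sigma sigma0 /andP[qr rn].
have s0 : 0 < sigma%:R :> R by rewrite ltr0n.
have r0' : (0 < r)%N by apply: leq_trans qr; rewrite muln_gt0 sigma0 andbT leq_max.
have r0 : 0 < r%:R :> R by rewrite ltr0n.
have n0 : 0 < n%:R :> R by rewrite ltr0n (leq_trans r0').
have n2 : (2 <= n)%N.
  apply: leq_trans (leq_trans qr rn); apply: (@leq_trans (2 * sigma)); first by lia.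
  by rewrite leq_mul2r leq_maxl orbT.
pose y : R := r%:R / sigma%:R; have y0 : 0 < y by rewrite divr_gt0.
have qy : q0%:R <= y by rewrite ler_pdivlMr // -natrM ler_nat.
have y1 : e^-1 <= y.
  apply: le_trans (ltW (archi_boundP _)) (le_trans _ qy); first by rewrite invr_ge0 ltW.
  by rewrite ler_nat !leq_max leqnn orbT.
have y2 : - ln e' / e' <= y.
  rewrite mulNr; apply: le_trans (ler_norm _) _; rewrite normrN.
  apply: le_trans (ltW (archi_boundP _)) (le_trans _ qy) => //.
  by rewrite ler_nat !leq_max leqnn !orbT.
have logy : log2 y <= e * y.
  have := ln_le_subr1 (mulr_gt0 e'0 y0); rewrite lnM ?posrE // => h.
  move: y2; rewrite ler_pdivrMr // => y2.
  rewrite /Defs.log2 ler_pdivrMr //.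
  have -> : e * y * ln 2 = 2 * (y * e') by rewrite /e'; field.
  lra.
have s_le : sigma%:R <= e * r%:R.
  move: y1; rewrite ler_pdivlMr // -(ler_pM2l e0) mulrA divff ?gt_eqF // mul1r.
  done.
have sy : sigma%:R * log2 y <= e * r%:R.
  apply: le_trans (ler_wpM2l (ltW s0) logy) _.
  by rewrite /y mulrCA [sigma%:R * _]mulrC divfK // gt_eqF.
have x0 := log2_nat_div_ge0 rn; have ls0 : 0 <= log2 sigma%:R by rewrite log2_ge0 ?ler1n.
have -> : lg n = (log2 (n%:R / r%:R) + log2 sigma%:R) + log2 y.
  by rewrite lgE // /y !log2_div //; ring.
have := ler_wpM2r (addr_ge0 x0 ls0) s_le; lra.
Qed.

(** The error depends only on the integer quotient of [r] by the alphabet size, which makes it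
    uniform over alphabets, strings and structures. *)
Lemma rle_space_vanishing : exists (C1 C2 : R) (eps : nat -> R),
  (eps @ \oo --> (0 : R))%classic /\
  forall Sigma : finType, (0 < #|Sigma|)%N ->
  forall (st : rle_str G B Sigma) (S : seq Sigma), rle_repr st S ->
    (rle_space K st)%:R <= rle_space_bound C1 C2 (eps (nruns S %/ #|Sigma|)%N)
                             (size S) (nruns S) #|Sigma|.
Proof.
have [C [C0 HC]] := rle_space_le.
have [M [M0 HM]] := HC 1 ltr01.
pose P q e := forall Sigma : finType, (0 < #|Sigma|)%N ->
  forall (st : rle_str G B Sigma) (S : seq Sigma), rle_repr st S ->
  (nruns S %/ #|Sigma|)%N = q ->
  (rle_space K st)%:R
    <= rle_space_bound (C + 1) (M + 2 * C) e (size S) (nruns S) #|Sigma|.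
have nrunsN (Sigma : finType) (S : seq Sigma) : (nruns S <= size S)%N.
  rewrite -(size_lens_runs S) -[nruns S](size_map snd); apply: size_le_sumn.
  by rewrite all_map; exact: runs_gt0.
have log_ratio n r : (2 <= r <= n)%N -> 1 <= log2 n%:R / lg r.
  case/andP=> r2 rn; rewrite ler_pdivlMr ?lg_gt0 // mul1r -lgE ?le_lg //.
  exact: leq_trans rn.
suff [eps [eps0 HP]] : exists eps : nat -> R,
    (eps @ \oo --> (0 : R))%classic /\ forall q, P q (eps q).
  exists (C + 1), (M + 2 * C), eps; split=> // Sigma Sigma0 st S stS.
  exact: HP.
(* The fallback [e = 1] must serve every quotient. For [r <= 1] the term [2 * r * C] is charged to
   the alphabet term, hence [M + 2 * C]; for [r >= 2] it is absorbed using [log n / log r >= 1]. *)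
apply: (@vanishing_choice _ _ 1).
  move=> _ Sigma Sigma0 st S stS _; apply: le_trans (HM _ Sigma0 _ _ stS) _.
  rewrite /rle_space_bound; set n := size S; set r := nruns S; set s : R := #|Sigma|%:R.
  have rn : (r <= n)%N := nrunsN _ S.
  have sn : 1 <= s * lg n by rewrite mulr_ege1 ?ler1n ?lg_ge1.
  set x := log2 (n%:R / r%:R); set z := 4 * x + log2 s + 4 * log2 (lg r).
  have -> : (M + 2 * C) * (s * lg n) = M * (s * lg n) + 2 * (C * (s * lg n)) by ring.
  have Csn : C <= C * (s * lg n) by rewrite ler_peMr.
  have [r2|r2] := leqP 2 r.
    have h : C <= (C + 1) * (log2 n%:R / lg r).
      have h1 := log_ratio n r (introT andP (conj r2 rn)).
      have := ler_wpM2l C0 h1; lra.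
    have := ler_wpM2l (ler0n R r) h; lra.
  have rC : r%:R * C <= C by rewrite ler_piMl // lern1.
  have : 0 <= r%:R * ((C + 1) * (log2 n%:R / lg r)).
    have [->|r0] := posnP r; first by rewrite mul0r.
    apply: mulr_ge0 => //; apply: mulr_ge0; first exact: addr_ge0.
    apply: divr_ge0; last exact/ltW/lg_gt0.
    by apply: log2_ge0; rewrite ler1n (leq_trans r0).
  lra.
(* Half of [e] is the relative error of the main term, the other half absorbs the alphabet term. The
   1 in [C + 1] provides the 1 in [sigma_lg_small]. *)
move=> e e0; have e20 : 0 < e / 2 by lra.
have [M' [M'0 HM']] := HC _ e20.
have M'1 : 0 < M' + 1 by lra.
have [q0 Hq0] := sigma_lg_small (divr_gt0 e20 M'1).
exists (maxn q0 2) => q; rewrite geq_max => /andP[q0q q2] Sigma Sigma0 st S stS rq.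
apply: le_trans (HM' _ Sigma0 _ _ stS) _; rewrite /rle_space_bound.
set n := size S; set r := nruns S; set s : R := #|Sigma|%:R.
have rn : (r <= n)%N := nrunsN _ S.
have qr : (q * #|Sigma| <= r)%N by rewrite -rq leq_divM.
have r2 : (2 <= r)%N.
  by apply: leq_trans qr; apply: leq_trans q2 _; rewrite leq_pmulr.
have := Hq0 n r #|Sigma| Sigma0; rewrite rn andbT.
move=> /(_ (leq_trans (leq_mul q0q (leqnn _)) qr)).
rewrite -/s; set x := log2 (n%:R / r%:R); set ll := log2 (lg r) => small.
have x0 : 0 <= x := log2_nat_div_ge0 rn.
have ll0 : 0 <= ll := log2_lg_ge0 R r.
have ls0 : 0 <= log2 s by rewrite log2_ge0 ?ler1n.
have sn0 : 0 <= s * lg n by rewrite mulr_ge0 // ltW // lg_gt0.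
have h : M' * (s * lg n) <= e / 2 * (r%:R * (x + log2 s + 1)).
  have := ler_wpM2l (ltW M'1) small.
  have -> : (M' + 1) * (e / 2 / (M' + 1) * (r%:R * (x + log2 s + 1)))
    = e / 2 * (r%:R * (x + log2 s + 1)) by field; rewrite gt_eqF.
  lra.
have h1 := ler_wpM2l (addr_ge0 C0 ler01) (log_ratio n r (introT andP (conj r2 rn))).
set y := (C + 1) * (log2 n%:R / lg r) in h1 *.
have C2 : 0 <= (M + 2 * C) * (s * lg n) by rewrite mulr_ge0 // addr_ge0 // mulr_ge0.
set z := 4 * x + log2 s + 4 * ll.
have z0 : 0 <= z by rewrite /z; lra.
have r0 : 0 <= r%:R :> R by [].
have hz : r%:R * (x + log2 s + 1) <= r%:R * (z + y) by rewrite ler_wpM2l // /z; lra.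
have hC : r%:R * (z + C) <= r%:R * (z + y) by rewrite ler_wpM2l //; lra.
have := ler_wpM2l (ltW e20) hz.
have e21 : 0 <= 1 + e / 2 by lra.
have := ler_wpM2l e21 hC; lra.
Qed.

End Space.

(** * Assembly of the space and time bounds *)

Lemma supports_weaken (R : realType) (B : dyn_bv) (dom dom' : pred (seq bool))
    (t t' : seq bool -> R) : supports B dom t ->
  (forall s, dom' s -> dom s) -> (forall s, dom' s -> (t s <= t' s)%R) ->
  supports B dom' t'.
Proof.
move=> sup dd tt; split; first exact: supports_empty sup.
- move=> v i dv iv; apply: (returns_weaken (supports_access sup (dd _ dv) iv)) => //.
  exact: tt.
- move=> v b i dv iv; apply: (returns_weaken (supports_rank sup b (dd _ dv) iv)) => //.
  exact: tt.
- move=> v b j dv jv; apply: (returns_weaken (supports_select sup (dd _ dv) jv)) => //.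
  exact: tt.
- move=> v i b dv iv dv'.
  apply: (returns_weaken (supports_insert sup (dd _ dv) iv (dd _ dv'))) => //.
  exact: tt.
Qed.

Lemma wt_repr_empty (B : dyn_bv) d : bits (bv_empty B) = [::] ->
  wt_repr d (wt_empty B d) [::].
Proof. by move=> B0; elim: d => //= d IH; rewrite B0. Qed.

Local Open Scope ring_scope.

Theorem theorem5 (R : realType) (G : gap_bv) (B : dyn_bv) (K : nat)
    (hG : gap_encoded R G) (hB : succinct R B) :
  exists (C1 C2 Ct : R) (eps : nat -> R),
    (eps @ \oo --> (0 : R))%classic /\
    forall Sigma : finType, (0 < #|Sigma|)%N ->
      rle_repr (rle_empty G B Sigma) [::] /\
      forall (st : rle_str G B Sigma) (S : seq Sigma), rle_repr st S ->
        let n := size S in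
        let r := nruns S in
        let t := Ct * (lg R #|Sigma| * lg R r) in
        (rle_space K st)%:R
          <= rle_space_bound C1 C2 (eps (r %/ #|Sigma|)%N) n r #|Sigma|
        /\ (forall c i, (i <= n)%N ->
              returns (rle_rank st c i) (fun k => k = str_rank c S i) t)
        /\ (forall c j, (0 < j <= count_mem c S)%N ->
              returns (rle_select st c j) (fun p => p = str_select c S j) t)
        /\ (forall i, (i < n)%N ->
              returns (rle_access st i) (fun h => h = onth S i) t)
        /\ (forall i c, (i <= n)%N ->
              returns (rle_insert st i c)
                (fun st' => rle_repr st' (str_insert S i c)) t).
Proof.
have [C1 [C2 [eps [eps0 space]]]] := rle_space_vanishing K hG hB.
have [CG [supG delG]] := gap_time hG; have [CB supB] := succinct_time hB.
(* [12 * |CB| + 6] bounds a traversal of the wavelet tree, of depth at most [2 * s] and with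
   [lg (r + 2) <= 3 * l] in each bitvector; [3 * |CG|] bounds a gap-encoded operation. The factor 40
   that follows is the budget of insertion, the largest one. *)
pose D : R := 12 * `|CB| + 3 * `|CG| + 6.
exists C1, C2, (40 * D), eps; split=> // Sigma Sigma0; split.
  split=> //= [||c]; last by rewrite ffunE (supports_empty supG).
  - exact/wt_repr_empty/(supports_empty supB).
  - exact: supports_empty supG.
move=> st S stS n r t.
pose N := r.+2; pose s := lg R #|Sigma|; pose l := lg R r.
have s1 : 1 <= s := lg_ge1 R _; have l1 : 1 <= l := lg_ge1 R _.
pose T := D * (s * l); pose tB := `|CB| * (3 * l).
have sl1 : 1 <= s * l by rewrite mulr_ege1.
have cB0 : 0 <= `|CB| by []. have cG0 : 0 <= `|CG| by [].
have l_sl : l <= s * l by rewrite ler_peMl //; lra.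
have s_sl : s <= s * l by rewrite ler_peMr //; lra.
have T1 : 1 <= T.
  have := mulr_ge0 cB0 (le_trans ler01 sl1); have := mulr_ge0 cG0 (le_trans ler01 sl1).
  by rewrite /T /D; lra.
have tB0 : 0 <= tB by rewrite mulr_ge0 //; lra.
have lgN k : (k <= N)%N -> lg R k <= 3 * l.
  by move=> kN; apply: le_trans (le_lg R kN) (lgSS_le R r).
have gT k : (k <= N)%N -> CG * lg R k <= T.
  move=> kN; apply: le_trans (_ : `|CG| * (3 * l) <= _).
    apply: le_trans (_ : `|CG| * lg R k <= _).
      by rewrite ler_wpM2r ?ler_norm // ltW // lg_gt0.
    by rewrite ler_wpM2l // lgN.
  have := ler_wpM2l cG0 l_sl; have := mulr_ge0 cB0 (le_trans ler01 sl1).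
  by rewrite /T /D; lra.
have supG' : supports G (fun v => gap_form v && (ones v <= N)%N) (fun=> T).
  by apply: (supports_weaken supG) => v /andP[// _ /gT].
have delG' (v : G) i : gap_form (bits v) -> (ones (bits v) <= N)%N ->
    (i < size (bits v))%N -> nth false (bits v) i = false ->
    returns (bv_delete0 v i) (fun v' => bits v' = str_delete (bits v) i) T.
  by move=> vf vN iv vi; apply: (returns_weaken (delG v i vf iv vi)) => //; exact: gT.
have supB' : supports B (fun v => size v <= N)%N (fun=> tB).
  apply: (supports_weaken supB) => // v vN.
  apply: le_trans (_ : `|CB| * lg R (size v) <= _).
    by rewrite ler_wpM2r ?ler_norm // ltW // lg_gt0.
  by rewrite ler_wpM2l // lgN.
have d_le := code_len_le_lg R Sigma0; rewrite -/s in d_le.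
have cBsl := mulr_ge0 cB0 (le_trans ler01 sl1).
have cGsl := mulr_ge0 cG0 (le_trans ler01 sl1).
have dT : (code_len Sigma)%:R <= T by rewrite /T /D; lra.
have wT : wt_time tB (code_len Sigma) <= T.
  apply: le_trans (_ : 2 * s * ((6 * `|CB| + 3) * l) <= _).
    apply: ler_pM => //; first by lra.
    by rewrite /tB; lra.
  by rewrite /T /D; lra.
have st_rs : represents st (runs S) by apply/rle_reprE.
have SE : expand (runs S) = S := runsK S.
have nE : n = sumn (lens (runs S)) by rewrite size_lens_runs.
have rN : (size (runs S) <= N)%N by rewrite !leqW.
have weak k (A : Type) (m : cost A) P :
    (k <= 40)%N -> returns m P (k%:R * T) -> returns m P t.
  move=> k40 H; apply: (returns_weaken H) => //.
  rewrite /t -mulrA -/s -/l -/T ler_wpM2r ?ler_nat //; lra.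
split; first exact: space.
split=> [c i i_n|].
  rewrite nE in i_n; rewrite -[in str_rank _ _ _]SE; apply: (weak 14) => //.
  exact: (rle_rank_correct T1 tB0 supG' supB' wT dT st_rs rN).
split=> [c j jS|].
  rewrite -SE in jS; rewrite -[in str_select _ _ _]SE; apply: (weak 10) => //.
  exact: (rle_select_correct T1 tB0 supG' supB' wT dT st_rs rN).
split=> [i i_n|i c i_n]; last first.
  apply: (weak 40%N) => //.
  exact: (rle_insert_correct T1 tB0 supG' delG' supB' wT dT c stS (leqnn _) i_n).
rewrite nE in i_n; have [a [c [m [b [ p [rsE iE pm]]]]]] := locate_position i_n.
have -> : onth S i = Some c.
  rewrite -SE rsE expand_cat expand_cons iE -size_expand onth_cat.
  by rewrite ltnNge leq_addr /= addKn onth_cat size_nseq pm onth_nseq pm.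
rewrite iE; apply: (weak 5) => //.
exact: (rle_access_correct T1 tB0 supG' supB' wT dT st_rs rN rsE).
Qed.
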